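(* Let $r\geq4$ be an even integer and let $\mathcal L_r=\{R_1,\ldots,R_r\}$ where each $R_i$ is a binary relation symbol. For each $n$, regard each $G=([n],c)\in M_r(n)$ as an $\mathcal L_r$-structure by interpreting, for $(x,y)\in[n]^2$, $R_i^G(x,y)$ iff $x\neq y$ and $c(xy)=\{i\}$. Then $M_r=\bigcup_{n\in\mathbb N}M_r(n)$ has a labeled first-order $0$-$1$ law: for every first-order $\mathcal L_r$-sentence $\psi$, the limit $\lim_{n\to\infty}\frac{|\{G\in M_r(n):G\models\psi\}|}{|M_r(n)|}$ exists and equals $0$ or $1$.
   Context: An $r$-graph is a pair $G=(V,c)$ with $c:\binom{V}{2}\to 2^{\{1,\ldots,r\}}$; simple means $|c(e)|\leq1$ for all $e$, complete means $c(e)\neq\emptyset$ for all $e$; for simple complete $G$, $d^G(x,y)$ is the unique element of $c(xy)$. $M_r(n)$ is the set of simple complete $r$-graphs $([n],c)$ with $d(x,z)\leq d(x,y)+d(y,z)$ for all pairwise distinct $x,y,z\in[n]$. *)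

(* Defs.v *)
From mathcomp Require Import all_boot.

Set Implicit Arguments.
Unset Strict Implicit.
Unset Printing Implicit Defensive.

(* The colour i in {1, ..., r}, and likewise the relation symbol R_i, is
   represented by the element of 'I_r with value i - 1. *)

Notation edge V := {e : {set V} | #|e| == 2}.

Notation r_graph r V := {ffun edge V -> {set 'I_r}}.

Section Graphs.
Variables (r : nat) (V : finType).
Implicit Types (G : r_graph r V) (x y z : V).

(* For x = y, where {x, y} is not an edge, the value is the junk value set0. *)
Definition colors G x y : {set 'I_r} := oapp G set0 (insub [set x; y]).

Definition simple_graph G : bool := [forall e, #|G e| <= 1].

Definition complete_graph G : bool := [forall e, G e != set0].

(* When G is simple and complete and x != y, this is the unique element of
   c(xy), shifted from {0, ..., r - 1} to {1, ..., r}. *)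
Definition dist G x y : nat :=
  if [pick i in colors G x y] is Some i then i.+1 else 0.

Definition triangle_ineq G : bool :=
  [forall x, forall y, forall z,
    [&& x != y, y != z & x != z] ==>
      (dist G x z <= dist G x y + dist G y z)].

End Graphs.

Definition M (r n : nat) : {set r_graph r 'I_n} :=
  [set G | [&& simple_graph G, complete_graph G & triangle_ineq G]].

(* First-order logic with equality over r binary relation symbols.  An element
   of [formula r k] is a formula whose free variables are among k variables
   (de Bruijn indices): a quantifier binds variable 0 of its body, and the
   remaining variables of the body are shifted by one. *)
Inductive formula (r : nat) : nat -> Type :=
| Equal k of 'I_k & 'I_k : formula r k
| Rel k of 'I_r & 'I_k & 'I_k : formula r k
| Not k of formula r k : formula r k
| And k of formula r k & formula r k : formula r k
| Or k of formula r k & formula r k : formula r k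
| Imply k of formula r k & formula r k : formula r k
| Forall k of formula r k.+1 : formula r k
| Exists k of formula r k.+1 : formula r k.

Definition sentence (r : nat) : Type := formula r 0.

Record lstructure (r : nat) : Type := LStructure {
  domain : Type;
  interp : 'I_r -> domain -> domain -> Prop
}.

Definition extend_valuation (T : Type) (k : nat) (a : T) (v : 'I_k -> T)
    (i : 'I_k.+1) : T :=
  oapp v a (unlift ord0 i).

Fixpoint holds (r : nat) (S : lstructure r) (k : nat) (phi : formula r k) :
    ('I_k -> domain S) -> Prop :=
  match phi in formula _ k return ('I_k -> domain S) -> Prop with
  | Equal _ x y => fun v => v x = v y
  | Rel _ i x y => fun v => interp i (v x) (v y)
  | Not _ p => fun v => ~ holds p v
  | And _ p q => fun v => holds p v /\ holds q v
  | Or _ p q => fun v => holds p v \/ holds q v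
  | Imply _ p q => fun v => holds p v -> holds q v
  | Forall _ p => fun v => forall a : domain S, holds p (extend_valuation a v)
  | Exists _ p => fun v => exists a : domain S, holds p (extend_valuation a v)
  end.

(* A sentence has no free variables, so its valuations are the functions with
   empty domain, which are all extensionally equal. *)
Definition models (r : nat) (S : lstructure r) (psi : sentence r) : Prop :=
  forall v : 'I_0 -> domain S, holds psi v.

Definition graph_structure (r : nat) (V : finType) (G : r_graph r V) :
    lstructure r :=
  {| domain := V;
     interp := fun i x y => x <> y /\ colors G x y = [set i] |}.

(* Main.v *)
Require Import Defs.
From mathcomp Require Import all_boot all_order all_algebra.
From mathcomp Require Import ring lra zify.
From mathcomp Require Import reals sequences exp.
Set Implicit Arguments.
Unset Strict Implicit.
Unset Printing Implicit Defensive.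
Import Order.TTheory GRing.Theory Num.Theory.

(* Write r = 2m.  Colourings with all distances in {m, ..., 2m} satisfy the
   triangle inequality, and there are (m+1)^C(n,2) of them.  The theorem reduces
   to showing that almost all elements of M_r(n) are of this kind: such a
   colouring is uniformly random, so almost surely has every extension property,
   and by back-and-forth any two structures with enough extension properties
   satisfy the same sentences of a given complexity.

   Almost all have only o(n^2) distances below m.  By an energy increment, the
   vertices of a metric colouring can be classified by their distances to
   boundedly many vertices so that adding any further vertex hardly increases the
   energy of the partition.  Then triangles are counted by the densities between
   classes, so that, up to few exceptional pairs, the distance of x and y lies in
   a set A(x, y) depending on the classes only, and for most triples the three
   sets are compatible: every choice of one distance from each satisfies the
   triangle inequality.  Three compatible subsets of {1, ..., 2m} have product of
   cardinalities at most (m+1)^3, with equality only for {m, ..., 2m}.  As there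
   are only exp(O(n)) classifications, this bounds the number of colourings with
   many small distances.

   Next, a vertex with many distances below m has a linear-sized neighbourhood in
   which all distances are at most 2m - 2, which is too expensive.  Finally, a
   single distance d(x, y) < m forbids d(x, z) = m, d(y, z) = 2m for all z, which
   loses a factor exponential in n in the number of ways to attach x and y to the
   remaining n - 2 vertices; the resulting recursion shows that such colourings
   are negligible. *)

(** * Averages over the classes of a partition *)

Local Open Scope ring_scope.

Section Average.
Variables (R : realFieldType) (I : finType).
Implicit Types (f g : I -> R).

(** The conditional expectation of [f] given the partition into the fibres of [t]; [energy] is its
    squared L2 norm, unnormalised. *)
Definition average (T : eqType) (t : I -> T) f p : R :=
  (\sum_(q | t q == t p) f q) / #|[pred q | t q == t p]|%:R.

Definition energy (T : eqType) (t : I -> T) f : R :=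
  \sum_p average t f p ^+ 2.

Section OnePartition.
Variables (T : eqType) (t : I -> T).

Lemma average_class f p q : t p = t q -> average t f p = average t f q.
Proof. by rewrite /average => ->. Qed.

Lemma class_card_neq0 p : #|[pred q | t q == t p]|%:R != 0 :> R.
Proof.
rewrite pnatr_eq0 -lt0n; apply/card_gt0P; exists p.
by rewrite inE.
Qed.

(** Averaging is the orthogonal projection onto the functions constant on classes, and [g] is such a
    function. *)
Lemma sum_average f g : (forall p q, t p = t q -> g p = g q) ->
  \sum_p average t f p * g p = \sum_p f p * g p.
Proof.
move=> gt; under eq_bigr => p _ do rewrite /average 2!mulr_suml.
rewrite (exchange_big_dep predT) //=; apply: eq_bigr => q _.
rewrite (eq_bigr (fun=> f q * g q / #|[pred p | t p == t q]|%:R)); last first.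
  move=> p /eqP tqp; rewrite tqp (gt p q) // mulrAC; congr (_ * _ / _%:R).
rewrite sumr_const -[RHS]mulr1 -[in RHS](divff (class_card_neq0 q)).
rewrite -mulr_natr (eq_card (B := [pred p | t p == t q])); last first.
  by move=> p; rewrite !inE eq_sym.
by ring.
Qed.

Lemma average_ge0 f p : (forall q, 0 <= f q) -> 0 <= average t f p.
Proof. by move=> f0; rewrite divr_ge0 ?sumr_ge0. Qed.

Lemma average_le1 f p : (forall q, f q <= 1) -> average t f p <= 1.
Proof.
move=> f1; rewrite ler_pdivrMr ?lt0r ?class_card_neq0 ?ler0n //.
by rewrite mul1r -sumr_const; apply: ler_sum => q _; exact: f1.
Qed.

Lemma energy_le_sum f : (forall q, 0 <= f q <= 1) ->
  energy t f <= \sum_p f p.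
Proof.
move=> f01; rewrite -[leRHS](eq_bigr _ (fun p _ => mulr1 (f p))).
rewrite -(sum_average f (g := fun=> 1)) //; apply: ler_sum => p _.
rewrite expr2 ler_wpM2l //.
  by apply: average_ge0 => q; case/andP: (f01 q).
by apply: average_le1 => q; case/andP: (f01 q).
Qed.

End OnePartition.

Section Refinement.
Variables (T T' : eqType) (t : I -> T) (t' : I -> T').
Hypothesis refine : forall p q, t' p = t' q -> t p = t q.

(** Pythagoras: the coarser average is the projection of the finer one, so the cross term is
    [energy t f]. *)
Lemma energy_diff f :
  energy t' f - energy t f = \sum_p (average t' f p - average t f p) ^+ 2.
Proof.
have E1 : \sum_p average t' f p * average t f p = energy t f.
  rewrite sum_average => [|p q /refine]; last exact: average_class.
  by rewrite -(sum_average f (t := t)) // => p q; apply: average_class.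
have E2 : \sum_p (average t' f p - average t f p) ^+ 2
  = \sum_p average t' f p ^+ 2 + \sum_p average t f p ^+ 2
    - (\sum_p average t' f p * average t f p) *+ 2.
  rewrite -sumrMnl -sumrN -!big_split /=; apply: eq_bigr => p _; ring.
rewrite E2 E1 /energy; ring.
Qed.

Lemma energy_refine f : energy t f <= energy t' f.
Proof. by rewrite -subr_ge0 energy_diff sumr_ge0 // => p _; rewrite sqr_ge0. Qed.

(* AM-GM in the form 2 |h g| <= h^2 / s + s g^2 plays the role of
   Cauchy-Schwarz. *)
Lemma average_approx f g s : 0 < s ->
    energy t' f <= energy t f + s ^+ 2 * #|I|%:R ->
    (forall p q, t' p = t' q -> g p = g q) -> (forall p, `|g p| <= 1) ->
  `|\sum_p (f p - average t f p) * g p| <= s * #|I|%:R.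
Proof.
move=> s0 le_en gt g1.
(* As [g] is constant on the finer classes, [f] may be replaced by its finer average. *)
have -> : \sum_p (f p - average t f p) * g p
        = \sum_p (average t' f p - average t f p) * g p.
  under eq_bigr do rewrite mulrBl; under [RHS]eq_bigr do rewrite mulrBl.
  by rewrite !sumrB (sum_average f gt).
apply: le_trans (ler_norm_sum _ _ _) _.
have le_p p : `|(average t' f p - average t f p) * g p|
   <= (average t' f p - average t f p) ^+ 2 * (2 * s)^-1 + s / 2.
  rewrite normrM -(ger0_norm (sqr_ge0 (_ - _))) normrX.
  set h := `|_ - _|; have h0 : 0 <= h by apply: normr_ge0.
  apply: (@le_trans _ _ h); first by rewrite ler_piMr.
  rewrite -subr_ge0.
  have -> : h ^+ 2 / (2 * s) + s / 2 - h = (h - s) ^+ 2 / (2 * s).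
    by field; rewrite gt_eqF.
  by rewrite divr_ge0 ?sqr_ge0 // mulr_ge0 ?ltW.
apply: le_trans (ler_sum _ (fun p _ => le_p p)) _.
rewrite big_split /= sumr_const -mulr_suml -energy_diff.
have -> : s * #|I|%:R = s ^+ 2 * #|I|%:R / (2 * s) + s / 2 *+ #|I|.
  by rewrite -[_ *+ #|I|]mulr_natr; field; rewrite gt_eqF.
have s2 : 0 <= (2 * s)^-1 by rewrite invr_ge0 mulr_ge0 // ltW.
by rewrite lerD2r ler_wpM2r // lerBlDl.
Qed.

End Refinement.
End Average.

(* The simple complete r-graphs are encoded by the function giving the element
   of each c(xy); as in Defs, the colour with value i is the distance i + 1. *)
Notation coloring r V := {ffun edge V -> 'I_r}.

(** * Colourings and their distances *)

Section Coloring.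
Variables (r : nat) (V : finType).
Implicit Types (D : coloring r V) (x y z : V).
Local Open Scope nat_scope.

(** The colour [c] stands for the distance [c.+1]; the default 0 is then the true distance on the
    diagonal, so [metric] can range over degenerate triples too. *)
Definition cdist D x y : nat := oapp (fun e => (D e).+1) 0 (insub [set x; y]).

Definition metric D : bool :=
  [forall x, forall y, forall z, cdist D x z <= cdist D x y + cdist D y z].

Lemma insub_edge (x y : V) (e : edge V) : val e = [set x; y] ->
  insub [set x; y] = Some e.
Proof. by move=> <-; rewrite valK. Qed.

Lemma edge_ends (e : edge V) : exists x y, x != y /\ val e = [set x; y].
Proof. by case: e => e /= /cards2P [x [y []]] xy ->; exists x, y. Qed.

Lemma insub_pairP x y : x != y ->
  exists2 e : edge V, insub [set x; y] = Some e & val e = [set x; y].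
Proof.
move=> xy; have xy2 : #|[set x; y]| == 2 by rewrite cards2 xy.
pose e : edge V := exist (fun A : {set V} => #|A| == 2) _ xy2.
by exists e => //; apply: insub_edge.
Qed.

Lemma insub_diag x : insub [set x; x] = None :> option (edge V).
Proof. by rewrite insubN // setUid cards1. Qed.

Lemma cdist_edge D (e : edge V) x y : val e = [set x; y] ->
  cdist D x y = (D e).+1.
Proof. by move=> /insub_edge; rewrite /cdist => ->. Qed.

Lemma cdistxx D x : cdist D x x = 0.
Proof. by rewrite /cdist insub_diag. Qed.

Lemma cdistC D x y : cdist D x y = cdist D y x.
Proof. by rewrite /cdist setUC. Qed.

Lemma cdist_gt0 D x y : (0 < cdist D x y) = (x != y).
Proof.
case: eqVneq => [->|xy]; first by rewrite cdistxx.
by have [e _ /(cdist_edge D) ->] := insub_pairP xy.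
Qed.

Lemma cdist_le D x y : cdist D x y <= r.
Proof.
case: (eqVneq x y) => [->|xy]; first by rewrite cdistxx.
by have [e _ /(cdist_edge D) ->] := insub_pairP xy.
Qed.

Lemma cdist_color D x y : x != y -> exists c : 'I_r, cdist D x y = c.+1.
Proof.
by move=> xy; have [e _ /(cdist_edge D) ->] := insub_pairP xy; exists (D e).
Qed.

Lemma metricP D :
  reflect (forall x y z, cdist D x z <= cdist D x y + cdist D y z) (metric D).
Proof.
apply: (iffP forallP) => [H x y z|H x].
  by have /forallP/(_ y)/forallP := H x; apply.
by apply/forallP => y; apply/forallP.
Qed.

End Coloring.

(** * Regular partitions of a metric colouring *)

Section Regularity.
Variables (R : realFieldType) (r : nat) (V : finType).
Variable (D : coloring r V).
Implicit Types (S : seq V) (c : 'I_r.+1).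

(** Here [c] is a distance, 0 included, so the indicators of a pair sum to 1; [lift ord0] turns a
    colour into a distance. *)
Definition color_ind c (p : V * V) : R := (cdist D p.1 p.2 == c)%:R.

(** Adding [z] to [S] makes every function of the distance to [z] constant on classes, which is what
    counting triangles through [z] requires. *)
Definition vtype S x : seq nat := [seq cdist D z x | z <- S].

Definition ptype S (p : V * V) := (vtype S p.1, vtype S p.2).

Definition density S c x y := average (ptype S) (color_ind c) (x, y).

Definition total_energy S := \sum_c energy (ptype S) (color_ind c).

Lemma color_ind01 c p : 0 <= color_ind c p <= 1.
Proof. by rewrite /color_ind; case: (_ == _); rewrite ?lexx ?ler01. Qed.

Lemma ptype_refine z S p q : ptype (z :: S) p = ptype (z :: S) q ->
  ptype S p = ptype S q.
Proof. by rewrite /ptype /= => -[_ -> _ ->]. Qed.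

Lemma total_energy_le S : total_energy S <= #|V|%:R ^+ 2.
Proof.
apply: le_trans (ler_sum _ (fun c _ => energy_le_sum _ (color_ind01 c))) _.
rewrite exchange_big /= -natrX expnS expn1 -card_prod -sumr_const.
apply: ler_sum => p _; pose c0 : 'I_r.+1 := inord (cdist D p.1 p.2).
have Ec0 : cdist D p.1 p.2 = c0 by rewrite inordK // ltnS cdist_le.
rewrite (bigD1 c0) //= big1 ?addr0; first by case/andP: (color_ind01 c0 p).
by move=> c; rewrite /color_ind Ec0 eq_sym -(inj_eq val_inj) /= => /negPf ->.
Qed.

(** No distance loses energy under refinement, so a single gain is at most the total gain. *)
Lemma energy_cons z S c :
  energy (ptype (z :: S)) (color_ind c) - energy (ptype S) (color_ind c)
    <= total_energy (z :: S) - total_energy S.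
Proof.
rewrite /total_energy -[leRHS]sumrB [leRHS](bigD1 c) //= lerDl sumr_ge0 // => i _.
by rewrite subr_ge0; apply: energy_refine; apply: ptype_refine.
Qed.

Definition regular (s : R) S := forall z,
  total_energy (z :: S) <= total_energy S + s ^+ 2 * #|{: V * V}|%:R.

(** Energy increment: while [S] is not regular, some vertex raises the energy by more than s^2 n^2.
    The energy is at most n^2, so K + 1 such steps are impossible. *)
Lemma exists_regular s (K : nat) : 1 < s ^+ 2 * K.+1%:R -> (0 < #|V|)%N ->
  exists2 S, (size S <= K)%N & regular s S.
Proof.
move=> sK V0.
pose reg S := [forall z,
  total_energy (z :: S) <= total_energy S + s ^+ 2 * #|{: V * V}|%:R].
have H j : (j <= K.+1)%N -> (exists2 S, (size S <= K)%N & reg S) \/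
  exists2 S, size S = j & j%:R * (s ^+ 2 * #|{: V * V}|%:R) <= total_energy S.
  elim: j => [_|j IH jK].
    right; exists [::] => //; rewrite mul0r sumr_ge0 // => c _.
    by rewrite sumr_ge0 // => p _; rewrite sqr_ge0.
  have [] := IH (ltnW jK); first by left.
  case=> S Sj ES; case rS: (reg S); first by left; exists S; rewrite ?Sj.
  move/negbT: rS; rewrite negb_forall => /existsP[z]; rewrite -ltNge => lt_z.
  right; exists (z :: S); rewrite /= ?Sj //.
  rewrite -natr1 mulrDl mul1r; apply/ltW/(le_lt_trans _ lt_z).
  by rewrite lerD2r.
have [[S SK /forallP rS]|[S _]] := H _ (leqnn _); first by exists S.
move=> /le_trans/(_ (total_energy_le S)); rewrite leNgt => /negP[].
rewrite mulrCA mulrA -[ltLHS]mul1r -natrX expnS expn1 -card_prod ltr_pM2r //.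
by rewrite ltr0n card_prod muln_gt0 V0.
Qed.

Lemma density_approx s S z c (g : V -> V -> R) : 0 < s -> regular s S ->
    (forall x y x' y', ptype (z :: S) (x, y) = ptype (z :: S) (x', y') ->
       g x y = g x' y') ->
    (forall x y, `|g x y| <= 1) ->
  `|\sum_x \sum_y ((cdist D x y == c)%:R - density S c x y) * g x y|
    <= s * #|V|%:R ^+ 2.
Proof.
move=> s0 rS gt g1; rewrite pair_big /=.
rewrite -natrX expnS expn1 -card_prod.
have := @average_approx _ _ _ _ (ptype S) (ptype (z :: S))
  (@ptype_refine z S) (color_ind c) (fun p => g p.1 p.2) s s0.
rewrite /density /color_ind => H;
  under eq_bigr => p _ do rewrite -surjective_pairing.
apply: H => [|[x y] [x' y'] /gt //|p]; last exact: g1.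
by rewrite -lerBlDl; apply: le_trans (energy_cons z S c) _; rewrite lerBlDl.
Qed.

Lemma density01 S c x y : 0 <= density S c x y <= 1.
Proof.
apply/andP; split; [apply: average_ge0|apply: average_le1] => p;
by case/andP: (color_ind01 c p).
Qed.

Lemma density_type S c x y x' y' : vtype S x = vtype S x' ->
  vtype S y = vtype S y' -> density S c x y = density S c x' y'.
Proof. by move=> Ex Ey; apply: average_class; rewrite /ptype /= Ex Ey. Qed.

Lemma densityC S c x y : density S c x y = density S c y x.
Proof.
have inj : injective (fun p : V * V => (p.2, p.1)).
  by move=> [? ?] [? ?] [-> ->].
have sw (p : V * V) : (ptype S (p.2, p.1) == ptype S (x, y))
    = (ptype S p == ptype S (y, x)).
  by rewrite /ptype /= !xpair_eqE andbC.
rewrite /density /average; congr (_ / _%:R).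
  rewrite (reindex_inj inj); apply: eq_big => [p|p _]; first exact: sw.
  by rewrite /color_ind (cdistC D p.1).
rewrite -!sum1_card (reindex_inj inj); apply: eq_bigl => p; exact: sw.
Qed.

Let F c x y : R := (cdist D x y == c)%:R.

Lemma sum_card (I : finType) (x : R) : \sum_(i : I) x = #|I|%:R * x.
Proof. by rewrite sumr_const mulr_natl. Qed.

(** The three indicators are replaced by densities one at a time. With the vertex opposite to the
    replaced pair fixed, the other two factors depend only on the classes refined by that vertex, so
    [density_approx] applies. *)
Lemma triangle_count s S a b c : 0 < s -> regular s S ->
  `|\sum_x \sum_y \sum_z F a x y * F b x z * F c y z
    - \sum_x \sum_y \sum_z density S a x y * density S b x z * density S c y z|
   <= 3 * s * #|V|%:R ^+ 3.
Proof.
move=> s0 rS; set d := density S.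
have F01 e x y : 0 <= F e x y <= 1 by apply: (color_ind01 e (x, y)).
have d01 e x y : 0 <= d e x y <= 1 by apply: density01.
have le1 (u v : R) : 0 <= u <= 1 -> 0 <= v <= 1 -> `|u * v| <= 1.
  case/andP=> u0 u1 /andP[v0 v1].
  by rewrite normrM !ger0_norm // mulr_ile1.
have Fz e z x x' : vtype (z :: S) x = vtype (z :: S) x' -> F e x z = F e x' z.
  by rewrite /F ![cdist _ _ z]cdistC => -[-> _].
have dt e z x x' y : vtype (z :: S) x = vtype (z :: S) x' -> d e x y = d e x' y.
  by move=> -[_ Ex]; apply: density_type.
have dt' e z x x' y : vtype (z :: S) x = vtype (z :: S) x' -> d e y x = d e y x'.
  by move=> -[_ Ex]; apply: density_type.
have B1 : `|\sum_z \sum_x \sum_y (F a x y - d a x y) * (F b x z * F c y z)|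
   <= #|V|%:R * (s * #|V|%:R ^+ 2).
  rewrite -sum_card; apply: le_trans (ler_norm_sum _ _ _) _.
  apply: ler_sum => z _; apply: (@density_approx s S z) => //.
    move=> x y x' y' [Ex Ex' Ey Ey'].
    by rewrite (Fz _ z x x') ?(Fz _ z y y') //= ?Ex ?Ex' ?Ey ?Ey'.
  by move=> x y; apply: le1.
have B2 : `|\sum_y \sum_x \sum_z (F b x z - d b x z) * (d a x y * F c y z)|
   <= #|V|%:R * (s * #|V|%:R ^+ 2).
  rewrite -sum_card; apply: le_trans (ler_norm_sum _ _ _) _.
  apply: ler_sum => y _; apply: (@density_approx s S y) => //.
    move=> x z x' z' [Ex Ex' Ez Ez']; rewrite (dt _ y x x') /= ?Ex ?Ex' //.
    by rewrite /F ![cdist _ y _]cdistC -/(F c z y) -/(F c z' y) (Fz _ y z z')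
      //= Ez Ez'.
  by move=> x z; apply: le1.
have B3 : `|\sum_x \sum_y \sum_z (F c y z - d c y z) * (d a x y * d b x z)|
   <= #|V|%:R * (s * #|V|%:R ^+ 2).
  rewrite -sum_card; apply: le_trans (ler_norm_sum _ _ _) _.
  apply: ler_sum => x _; apply: (@density_approx s S x) => //.
    move=> y z y' z' [Ey Ey' Ez Ez']; rewrite (dt' _ x y y') /= ?Ey ?Ey' //.
    by rewrite (dt' _ x z z') //= ?Ez ?Ez'.
  by move=> y z; apply: le1.
rewrite (exchange_big_dep predT) //= in B2.
have E1 : \sum_z \sum_x \sum_y (F a x y - d a x y) * (F b x z * F c y z)
   = \sum_x \sum_y \sum_z (F a x y - d a x y) * (F b x z * F c y z).
  by rewrite exchange_big; apply: eq_bigr => x _; rewrite exchange_big.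
rewrite E1 in B1.
rewrite -!sumrB.
(* Telescoping, in the order [a], [b], [c]. *)
have -> : \sum_x (\sum_y \sum_z F a x y * F b x z * F c y z
       - \sum_y \sum_z d a x y * d b x z * d c y z)
  = \sum_x \sum_y \sum_z (F a x y - d a x y) * (F b x z * F c y z)
   + (\sum_x \sum_y \sum_z (F b x z - d b x z) * (d a x y * F c y z)
   + \sum_x \sum_y \sum_z (F c y z - d c y z) * (d a x y * d b x z)).
  rewrite -!big_split /=; apply: eq_bigr => x _.
  rewrite -sumrB -!big_split /=; apply: eq_bigr => y _.
  rewrite -sumrB -!big_split /=; apply: eq_bigr => z _; ring.
apply: le_trans (ler_normD _ _) _.
apply: le_trans (lerD B1 (le_trans (ler_normD _ _) (lerD B2 B3))) _.
by rewrite le_eqVlt; apply/orP; left; apply/eqP; ring.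
Qed.

End Regularity.

(** * Profiles: sets of allowed distances *)

Section Profile.
Variables (r : nat) (V : finType).
Implicit Types (A : V -> V -> {set 'I_r}) (x y z : V).

(** Only the inequality with long side xy is tested; the other two arise by permuting the
    vertices. *)
Definition incompatible A x y z : bool :=
  [exists a in A x y, exists b in A x z, exists c in A y z,
    (b.+1 + c.+1 < a.+1)%N].

Definition exceptional (D : coloring r V) A x y : bool :=
  [exists c : 'I_r, (cdist D x y == c.+1) && (c \notin A x y)].

End Profile.

Lemma card_pairs (R : pzSemiRingType) (V : finType) (P : V -> V -> bool) :
  \sum_x \sum_y (P x y)%:R = #|[pred p : V * V | P p.1 p.2]|%:R :> R.
Proof. by rewrite pair_big /= -sum1_card natr_sum [RHS]big_mkcond;
  apply: eq_bigr => p _; rewrite inE; case: ifP. Qed.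

Lemma card_triples (R : pzSemiRingType) (V : finType) (P : V -> V -> V -> bool) :
  \sum_x \sum_y \sum_z (P x y z)%:R
    = #|[pred t : V * V * V | P t.1.1 t.1.2 t.2]|%:R :> R.
Proof. by rewrite pair_big pair_big /= -sum1_card natr_sum [RHS]big_mkcond;
  apply: eq_bigr => p _; rewrite inE; case: ifP. Qed.

(** The set A(x, y) consists of the distances of density at least [eta] between the classes of x and
    y. Rarer distances account for few pairs. An incompatible triple gives a forbidden distance
    triple whose densities have product at least eta^3, whereas metric colourings contain no such
    triangle; [triangle_count] then bounds these triples. As [K] is independent of [V], there are
    only exp(O(n)) choices of [tau] and [B]. *)
Lemma regular_profile (R : archiRealFieldType) (r : nat) (theta : R) :
    0 < theta -> exists K : nat,
  forall (V : finType) (D : coloring r V), (0 < #|V|)%N -> metric D ->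
  exists (tau : {ffun V -> {ffun 'I_K -> 'I_r.+1}})
         (B : {ffun {ffun 'I_K -> 'I_r.+1} * {ffun 'I_K -> 'I_r.+1}
               -> {set 'I_r}}),
  let A x y := B (tau x, tau y) in
  [/\ forall x y, A x y = A y x,
      #|[pred p : V * V | exceptional D A p.1 p.2]|%:R <= theta * #|V|%:R ^+ 2
    & #|[pred t : V * V * V | incompatible A t.1.1 t.1.2 t.2]|%:R
        <= theta * #|V|%:R ^+ 3].
Proof.
move=> theta0; have r0 : 0 < r.+1%:R :> R by rewrite ltr0n.
have [eta eta0 thetaE] : exists2 eta : R, 0 < eta & theta = r.+1%:R * eta.
  by exists (theta / r.+1%:R); rewrite ?divr_gt0 // mulrC divfK ?gt_eqF.
(* With this [s], the errors 3 s n^3 / eta^3 of at most r^3 distance triples add up to at most theta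
   n^3. *)
have [s s0 sE] : exists2 s : R, 0 < s & s = theta * eta ^+ 3 / (3 * r.+1%:R ^+ 3).
  by eexists; last reflexivity; rewrite divr_gt0 ?mulr_gt0 ?exprn_gt0 ?ltr0n.
have s20 : 0 < s ^+ 2 by apply: exprn_gt0.
exists (Num.bound (s ^+ 2)^-1) => V D V0 /metricP metD.
have [|S SK regS] := exists_regular D (s := s) (K := Num.bound (s ^+ 2)^-1) _ V0.
  rewrite mulrC -ltr_pdivrMr // mul1r.
  apply: lt_le_trans (archi_boundP _) _; first by rewrite invr_ge0 ltW.
  by rewrite ler_nat.
move: SK; set K := Num.bound _ => SK.
pose d (c : 'I_r) x y := density R D S (lift ord0 c) x y.
(* If [S] has fewer than [K] vertices, the types are padded with the default 0. *)
pose tau := [ffun x => [ffun i : 'I_K => inord (nth 0%N (vtype D S x) i)]]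
  : {ffun V -> {ffun 'I_K -> 'I_r.+1}}.
pose B := [ffun p : {ffun 'I_K -> 'I_r.+1} * {ffun 'I_K -> 'I_r.+1} =>
  [set c | [exists x, exists y, [&& tau x == p.1, tau y == p.2
     & eta <= d c x y]]]].
have tauE x y : tau x = tau y -> vtype D S x = vtype D S y.
  rewrite !ffunE => /ffunP E; apply: (eq_from_nth (x0 := 0%N));
    rewrite ?size_map //.
  move=> i iS; have iK : (i < K)%N by apply: leq_trans SK.
  have := E (Ordinal iK); rewrite !ffunE /= => /(congr1 val) /=.
  have lt_r w : (nth 0%N (vtype D S w) i < r.+1)%N.
    by rewrite (nth_map x) // ltnS cdist_le.
  by rewrite !inordK.
have BE x y : B (tau x, tau y) = [set c | eta <= d c x y].
  rewrite ffunE; apply/setP => c; rewrite !inE; apply/existsP/idP => /=.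
    case=> x' /existsP[y' /and3P[/eqP/tauE Ex /eqP/tauE Ey]].
    by rewrite /d (density_type _ _ Ex Ey).
  by move=> le_d; exists x; apply/existsP; exists y; rewrite !eqxx.
have d01 c x y : 0 <= d c x y <= 1 by apply: density01.
have d0 c x y : 0 <= d c x y by case/andP: (d01 c x y).
exists tau, B => /=; split.
- by move=> x y; rewrite !BE; apply/setP => c; rewrite !inE /d densityC.
- have le_exc x y : (exceptional D (fun x y => B (tau x, tau y)) x y)%:R
     <= \sum_(c : 'I_r) (cdist D x y == lift ord0 c)%:R * (d c x y < eta)%R%:R
       :> R.
    case: (boolP (exceptional _ _ _ _)) => [/existsP[c /andP[Ec]]|_]; last first.
      by rewrite sumr_ge0 // => c _; rewrite mulr_ge0.
    rewrite BE inE -ltNge => lt_d;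
      rewrite (bigD1 c) //= lt_d mulr1 /= /bump /= add1n Ec.
    by rewrite lerDl sumr_ge0 // => i _; rewrite mulr_ge0.
  rewrite -card_pairs.
  apply: le_trans (ler_sum _ (fun x _ => ler_sum _ (fun y _ => le_exc x y))) _.
  (* The cutoff depends on the classes only, so the indicator may be replaced by its average [d c],
     which is below [eta] where the cutoff is 1. *)
  have -> : \sum_x \sum_y \sum_(c : 'I_r)
        (cdist D x y == lift ord0 c)%:R * (d c x y < eta)%R%:R
     = \sum_(c : 'I_r) \sum_x \sum_y d c x y * (d c x y < eta)%R%:R :> R.
    under eq_bigr do rewrite exchange_big; rewrite exchange_big /=.
    apply: eq_bigr => c _; rewrite pair_big [RHS]pair_big /=.
    rewrite -[LHS](sum_average (t := ptype D S) (color_ind R D (lift ord0 c)))/=.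
      by apply: eq_bigr => -[x y].
    move=> [x y] [x' y'] [Ex Ey] /=.
    by rewrite /d (density_type _ _ (x' := x') (y' := y')).
  apply: (@le_trans _ _ (\sum_(c : 'I_r) \sum_(x : V) \sum_(y : V) eta)).
    apply: ler_sum => c _; apply: ler_sum => x _; apply: ler_sum => y _.
    by case: ltrP => [/ltW|]; rewrite ?mulr1 // mulr0 (ltW eta0).
  rewrite !sum_card card_ord.
  rewrite thetaE.
  have -> : r%:R * (#|V|%:R * (#|V|%:R * eta)) =
    r%:R * eta * #|V|%:R ^+ 2 by ring.
  by rewrite ler_wpM2r ?exprn_ge0 // ler_wpM2r ?(ltW eta0) // ler_nat.
- have le_inc x y z : (incompatible (fun x y => B (tau x, tau y)) x y z)%:R
     <= \sum_(a : 'I_r) \sum_(b : 'I_r) \sum_(c : 'I_r)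
          (b.+1 + c.+1 < a.+1)%N%:R * (d a x y * d b x z * d c y z / eta ^+ 3).
    have t0 (a b c : 'I_r) : 0 <= (b.+1 + c.+1 < a.+1)%N%:R
        * (d a x y * d b x z * d c y z / eta ^+ 3).
      apply: mulr_ge0 => //; apply: divr_ge0; last by rewrite exprn_ge0 // ltW.
      by do 2?[apply: mulr_ge0 => //].
    case: (boolP (incompatible _ _ _ _)) => [|_]; last first.
      by do 3![rewrite sumr_ge0 // => ? _].
    case/existsP=> a /andP[]; rewrite BE inE => da.
    case/existsP=> b /andP[]; rewrite BE inE => db.
    case/existsP=> c /andP[]; rewrite BE inE => dc lt_abc.
    rewrite (bigD1 a) //= (bigD1 b) //= (bigD1 c) //= lt_abc mul1r.
    rewrite -!addrA; apply: (@le_trans _ _ (d a x y * d b x z * d c y z / eta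
      ^+ 3)).
      rewrite ler_pdivlMr ?exprn_gt0 // mul1r !exprS expr0 mulr1 mulrA.
      by do 2?[apply: ler_pM => //]; rewrite ?mulr_ge0 ?(ltW eta0).
    rewrite lerDl !addr_ge0 //.
    - by rewrite sumr_ge0.
    - by rewrite sumr_ge0 // => ? _; rewrite sumr_ge0.
    by rewrite sumr_ge0 // => ? _; rewrite sumr_ge0 // => ? _; rewrite sumr_ge0.
  rewrite -card_triples.
  apply: le_trans (ler_sum _ (fun x _ => ler_sum _ (fun y _ =>
    ler_sum _ (fun z _ => le_inc x y z)))) _.
  have -> : \sum_x \sum_y \sum_z \sum_(a : 'I_r) \sum_(b : 'I_r) \sum_(c : 'I_r)
          (b.+1 + c.+1 < a.+1)%N%:R * (d a x y * d b x z * d c y z / eta ^+ 3)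
     = \sum_(a : 'I_r) \sum_(b : 'I_r) \sum_(c : 'I_r)
          (b.+1 + c.+1 < a.+1)%N%:R *
           ((\sum_x \sum_y \sum_z d a x y * d b x z * d c y z) / eta ^+ 3).
    pose G x y z (a b c : 'I_r) := (b.+1 + c.+1 < a.+1)%N%:R
       * (d a x y * d b x z * d c y z / eta ^+ 3).
    transitivity (\sum_(p : V * V * V) \sum_(q : 'I_r * 'I_r * 'I_r)
       G p.1.1 p.1.2 p.2 q.1.1 q.1.2 q.2).
      rewrite pair_big pair_big; apply: eq_bigr => p _.
      by rewrite [LHS]pair_big [LHS]pair_big.
    rewrite exchange_big [RHS]pair_big [RHS]pair_big; apply: eq_bigr => q _ /=.
    rewrite [\sum_x \sum_y _]pair_big [X in X / _]pair_big /= mulr_suml mulr_sumr.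
    by apply: eq_bigr.
  apply: (@le_trans _ _ (\sum_(a : 'I_r) \sum_(b : 'I_r) \sum_(c : 'I_r)
     (3 * s * #|V|%:R ^+ 3 / eta ^+ 3))).
    apply: ler_sum => a _; apply: ler_sum => b _; apply: ler_sum => c _.
    have pos : 0 <= 3 * s * #|V|%:R ^+ 3 / eta ^+ 3.
      by rewrite divr_ge0 ?mulr_ge0 ?exprn_ge0 ?(ltW eta0) ?(ltW s0).
    case: ltnP => [lt_abc|_]; last by rewrite mul0r.
    rewrite mul1r ler_wpM2r ?invr_ge0 ?exprn_ge0 ?(ltW eta0) //.
    have := triangle_count (lift ord0 a) (lift ord0 b) (lift ord0 c) s0 regS.
    (* The true count of triangles with these distances is zero, by the triangle inequality. *)
    rewrite [X in `|X - _|]big1 ?sub0r ?normrN.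
      by apply: le_trans; apply: ler_norm.
    move=> x _; rewrite big1 // => y _; rewrite big1 // => z _.
    rewrite -!natrM !mulnb; case: andP => // -[/andP[/eqP Ea /eqP Eb] /eqP Ec].
    have := metD x z y; rewrite Ea Eb [cdist D z y]cdistC Ec /= /bump /= !add1n.
    by rewrite leqNgt lt_abc.
  rewrite !sum_card card_ord.
  have -> : r%:R * (r%:R * (r%:R * (3 * s * #|V|%:R ^+ 3 / eta ^+ 3)))
     = theta * #|V|%:R ^+ 3 * (r%:R ^+ 3 / r.+1%:R ^+ 3).
    by rewrite sE; field; rewrite addrC natr1 !gt_eqF.
  rewrite -[leRHS]mulr1 ler_wpM2l ?mulr_ge0 ?exprn_ge0 ?(ltW theta0) //.
  by rewrite ler_pdivrMr ?exprn_gt0 // mul1r lerXn2r ?nnegrE // ler_nat.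
Qed.

(** * Counting near a product set and compatible triples *)

(* Each F contributes at least exp (- s k) to the generating function on the
   right-hand side, where points outside A have weight exp (- s). *)
Lemma near_product_card (R : realType) (I C : finType) (A : I -> {set C})
    (s k : R) : 0 <= s ->
  #|[pred F : {ffun I -> C} | #|[pred i | F i \notin A i]|%:R <= k]|%:R
    <= expR (s * k) * \prod_i (#|A i|%:R + expR (- s) * #|C|%:R).
Proof.
move=> s0; pose w i c : R := if c \in A i then 1 else expR (- s).
have w0 i c : 0 <= w i c by rewrite /w; case: ifP; rewrite ?expR_ge0.
have le1 : \sum_(F : {ffun I -> C}) \prod_i w i (F i)
    <= \prod_i (#|A i|%:R + expR (- s) * #|C|%:R).
  rewrite -bigA_distr_bigA; apply: ler_prod => i _.
  rewrite sumr_ge0 //= (bigID (mem (A i))) /=; apply: lerD.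
    by rewrite (eq_bigr (fun=> 1)) ?sumr_const // => c; rewrite /w => ->.
  rewrite (eq_bigr (fun=> expR (- s))) => [|c /negPf cA]; last by rewrite /w cA.
  by rewrite sumr_const -[_ *+ _]mulr_natr ler_wpM2l ?expR_ge0 // ler_nat
    max_card.
apply: le_trans (ler_wpM2l (expR_ge0 _) le1).
rewrite mulr_sumr -sum1_card natr_sum big_mkcond; apply: ler_sum => F _.
have -> : \prod_i w i (F i) = expR (- s) ^+ #|[pred i | F i \notin A i]|.
  rewrite -prodr_const [RHS]big_mkcond; apply: eq_bigr => i _.
  by rewrite /w !inE; case: (_ \in _).
case: ifP; rewrite inE => Fk; last first.
  by rewrite mulr_ge0 ?exprn_ge0 ?expR_ge0.
rewrite -expRM_natl -expRD -[leLHS]expR0 ler_expR mulrN mulrC -mulrBl.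
by rewrite mulr_ge0 // subr_ge0.
Qed.

Lemma prod_expR_ln (R : realType) (I : finType) (P : pred I) (w : I -> R) :
  (forall i, 0 < w i) -> \prod_(i | P i) w i = expR (\sum_(i | P i) ln (w i)).
Proof. by move=> w0; rewrite expR_sum; apply: eq_bigr => i _;
  rewrite lnK ?posrE. Qed.

(** AM-GM through an identity: 54 a b c is 2 S^3 minus the nonnegative terms S Q and 6 T. Strictness
    comes from S < 3 p or, when S = 3 p, from S Q > 0. *)
Lemma agm3_int (a b c p : int) : 0 <= a -> 0 <= b -> 0 <= c -> 0 <= p ->
  a + b + c <= 3 * p -> ~~ [&& a == p, b == p & c == p] -> a * b * c < p ^+ 3.
Proof.
move=> a0 b0 c0 p0 le_S neq; set S := a + b + c in le_S.
pose Q := (a - b) ^+ 2 + (b - c) ^+ 2 + (c - a) ^+ 2.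
pose T := a * (b - c) ^+ 2 + b * (c - a) ^+ 2 + c * (a - b) ^+ 2.
have E : 54 * (a * b * c) = 2 * S ^+ 3 - S * Q - 6 * T by rewrite /S /Q /T; ring.
have S0 : 0 <= S by rewrite !addr_ge0.
have Q0 : 0 <= Q by rewrite !addr_ge0 ?sqr_ge0.
have T0 : 0 <= T by rewrite !addr_ge0 // mulr_ge0 ?sqr_ge0.
suff : 54 * (a * b * c) < 54 * p ^+ 3 by rewrite ltr_pM2l.
have -> : 54 * p ^+ 3 = 2 * (3 * p) ^+ 3 by ring.
have SQ0 : 0 <= S * Q by apply: mulr_ge0.
rewrite {}E; have [ltS|eqS] : S < 3 * p \/ S = 3 * p by lia.
  have : S ^+ 3 < (3 * p) ^+ 3 by rewrite ltrXn2r // ?nnegrE ?mulr_ge0.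
  move: SQ0 T0; move: (S ^+ 3) ((3 * p) ^+ 3) (S * Q) (T : int) => u v w t; lia.
have : 0 < S * Q.
  rewrite lt0r SQ0 andbT mulf_neq0 //.
    by apply: contraNneq neq => S00; move: (S00); rewrite /S; lia.
  apply: contraNneq neq => Q00.
  have := sqr_ge0 (a - b); have := sqr_ge0 (b - c); have := sqr_ge0 (c - a).
  rewrite /Q in Q00 => h1 h2 h3.
  have /eqP : (a - b) ^+ 2 = 0 by lia.
  have /eqP : (b - c) ^+ 2 = 0 by lia.
  rewrite !sqrf_eq0 !subr_eq0 => /eqP bc /eqP ab; move: eqS; rewrite /S; lia.
by rewrite eqS; move: T0; move: ((3 * p) ^+ 3) (3 * p * Q) T => u v w; lia.
Qed.

Section Nat.
Local Open Scope nat_scope.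

(** The boolean, read as a number, records a gain of 1 outside the equality case, in a form that can
    be summed over triples. *)
Lemma agm3 (a b c p : nat) : a + b + c <= 3 * p ->
  a * b * c + ~~ [&& a == p, b == p & c == p] <= p ^ 3.
Proof.
move=> le_S; case: (boolP [&& _, _ & _]) => [/and3P[/eqP-> /eqP-> /eqP->]|neq].
  by rewrite addn0 !expnS expn0 muln1 mulnA.
have /(_ _ _ _ _ _ neq) := @agm3_int a%:Z b%:Z c%:Z p%:Z.
rewrite addn1 /= -ltz_nat !expnS expn0 muln1 !PoszM !exprS expr0 mulr1.
by apply => //; lia.
Qed.

Definition big_colors (r m : nat) : {set 'I_r} := [set c : 'I_r | m <= c.+1].

Lemma card_big_colors m : 0 < m -> #|big_colors (2 * m) m| = m.+1.
Proof.
move=> m0; have lt_m (i : 'I_m.+1) : m.-1 + i < 2 * m by have := ltn_ord i; lia.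
pose f i := Ordinal (lt_m i).
have f_inj : injective f by move=> i j /(congr1 val) /= ?;
  apply: val_inj => /=; lia.
rewrite -[RHS]card_ord -(card_imset _ f_inj); apply: eq_card => c.
rewrite inE; apply/idP/imsetP => [mc|[i _ ->]] /=; last by lia.
have cm : c - m.-1 < m.+1 by have := ltn_ord c; lia.
by exists (Ordinal cm) => //; apply: val_inj => /=; lia.
Qed.

Lemma interval_card r (A : {set 'I_r}) (a0 a1 : nat) :
  (forall a : 'I_r, a \in A -> a0 <= a <= a1) -> a0 <= a1 ->
  #|A| <= a1 - a0 + 1.
Proof.
move=> Ab le_a; have inj : {in A &, injective (fun a : 'I_r =>
  inord (a - a0) : 'I_(a1 - a0).+1)}.
  move=> a b aA bA /(congr1 val); rewrite /= !inordK; have := Ab _ aA;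
    have := Ab _ bA; try lia.
  by move=> ? ? ?; apply: val_inj => /=; lia.
by rewrite -(card_in_imset inj) addn1 -[leqRHS]card_ord max_card.
Qed.

(* With a, b, c the least distances in A, B, C, the cardinality of A is at most
   min (2m, b + c) - a + 1, so the three cardinalities add up to at most
   min (s, 6m - s) + 3 where s = a + b + c. *)
Lemma compatible_card m (A B C : {set 'I_(2 * m)}) : 0 < m ->
    (forall a b c : 'I_(2 * m), a \in A -> b \in B -> c \in C ->
       [/\ a.+1 <= b.+1 + c.+1, b.+1 <= a.+1 + c.+1 & c.+1 <= a.+1 + b.+1]) ->
  #|A| * #|B| * #|C| +
    ~~ [&& A == big_colors _ m, B == big_colors _ m & C == big_colors _ m]
    <= m.+1 ^ 3.
Proof.
move=> m0 compat; case: (set_0Vmem A) => [->|[a1 a1A]].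
  by rewrite cards0 !mul0n; case: (~~ _); rewrite // expn_gt0.
case: (set_0Vmem B) => [->|[b1 b1B]].
  by rewrite cards0 muln0 !mul0n; case: (~~ _); rewrite // expn_gt0.
case: (set_0Vmem C) => [->|[c1 c1C]].
  by rewrite cards0 !muln0; case: (~~ _); rewrite // expn_gt0.
have [a aA amin] := arg_minnP (fun a : 'I_(2 * m) => a : nat) a1A.
have [b bB bmin] := arg_minnP (fun a : 'I_(2 * m) => a : nat) b1B.
have [c cC cmin] := arg_minnP (fun a : 'I_(2 * m) => a : nat) c1C.
have A1 : #|A| <= (2 * m).-1 - a + 1.
  apply: interval_card => [x xA|]; last by have := ltn_ord a; lia.
  by have := amin x xA; have := ltn_ord x; lia.
have B1 : #|B| <= (2 * m).-1 - b + 1.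
  apply: interval_card => [x xA|]; last by have := ltn_ord b; lia.
  by have := bmin x xA; have := ltn_ord x; lia.
have C1 : #|C| <= (2 * m).-1 - c + 1.
  apply: interval_card => [x xA|]; last by have := ltn_ord c; lia.
  by have := cmin x xA; have := ltn_ord x; lia.
have [abc bac cab] := compat a b c aA bB cC.
(* For colours, [x.+1 <= b.+1 + c.+1] reads [x <= b + c + 1], whence the additional 1. *)
have A2 : #|A| <= b + c + 1 - a + 1.
  apply: interval_card => [x xA|]; last by lia.
  by have [? _ _] := compat x b c xA bB cC; have := amin x xA; lia.
have B2 : #|B| <= a + c + 1 - b + 1.
  apply: interval_card => [x xA|]; last by lia.
  by have [_ ? _] := compat a x c aA xA cC; have := bmin x xA; lia.
have C2 : #|C| <= a + b + 1 - c + 1.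
  apply: interval_card => [x xA|]; last by lia.
  by have [_ _ ?] := compat a b x aA bB xA; have := cmin x xA; lia.
have lta := ltn_ord a; have ltb := ltn_ord b; have ltc := ltn_ord c.
apply: leq_trans (agm3 (a := #|A|) (b := #|B|) (c := #|C|) _); last by lia.
rewrite leq_add2l; case: (boolP [&& #|A| == _, _ & _]) => [|_];
  last exact: leq_b1.
case/and3P=> /eqP EA /eqP EB /eqP EC.
(* If all cardinalities are m + 1, the first three bounds give least colours at most m - 1, and the
   last three give their sum at least 3 (m - 1). *)
have [Ea [Eb Ec]] : a = m.-1 :> nat /\ (b = m.-1 :> nat /\ c = m.-1 :> nat).
  by rewrite EA EB EC in A1 B1 C1 A2 B2 C2; lia.
have sub (X : {set 'I_(2 * m)}) : #|X| = m.+1 ->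
  (forall x : 'I_(2 * m), x \in X -> m.-1 <= x) ->
    X == big_colors (2 * m) m.
  move=> EX Xm; rewrite eqEcard card_big_colors // EX leqnn andbT.
  by apply/subsetP => x /Xm; rewrite inE; lia.
rewrite !sub // => x xX; first by rewrite -Ec cmin.
  by rewrite -Eb bmin.
by rewrite -Ea amin.
Qed.
End Nat.

(** * The weight of a profile *)

Section EdgeSums.
Variable V : finType.
Implicit Types (e : edge V) (x y : V).

Lemma ends_exists e :
  exists p : V * V, (p.1 != p.2) && (val e == [set p.1; p.2]).
Proof. by have [x [y [xy ->]]] := edge_ends e; exists (x, y);
  rewrite /= xy eqxx. Qed.

(** An arbitrary but fixed order of the two ends, which lets functions of ordered pairs be evaluated
    at edges. *)
Definition ends e : V * V := xchoose (ends_exists e).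

Lemma ends_neq e : (ends e).1 != (ends e).2.
Proof. by case/andP: (xchooseP (ends_exists e)). Qed.

Lemma val_ends e : val e = [set (ends e).1; (ends e).2].
Proof. by case/andP: (xchooseP (ends_exists e)) => _ /eqP. Qed.

Lemma ends_inj : injective ends.
Proof. by move=> e e' E; apply: val_inj; rewrite /= !val_ends E. Qed.

Lemma set2_eq (x y u v : V) : u != v -> [set x; y] = [set u; v] ->
  (u, v) = (x, y) \/ (u, v) = (y, x).
Proof.
move=> uv E; have : u \in [set x; y] by rewrite E !inE eqxx.
have : v \in [set x; y] by rewrite E !inE eqxx orbT.
rewrite !inE => /orP[]/eqP Ev /orP[]/eqP Eu; move: uv; rewrite Eu Ev ?eqxx //;
  auto.
Qed.

Lemma sum_edges (W : zmodType) (g : V -> V -> W) : (forall x y, g x y = g y x) ->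
  \sum_x \sum_(y | x != y) g x y =
    (\sum_(e : edge V) g (ends e).1 (ends e).2) *+ 2.
Proof.
move=> gC; rewrite pair_big_dep /=.
transitivity (\sum_(p : V * V | p.1 != p.2)
   \sum_(e : edge V | val e == [set p.1; p.2]) g p.1 p.2).
  apply: eq_bigr => -[x y] /= xy; have [e _ Ee] := insub_pairP xy.
  by rewrite (big_pred1 e) // => e'; rewrite -Ee (inj_eq val_inj).
rewrite (exchange_big_dep predT) //= -sumrMnl; apply: eq_bigr => e _.
move: (ends_neq e) (val_ends e); set p := ends e => neq Ee.
have swap_neq : (p.2, p.1) != p.
  by apply: contra neq => /eqP/(congr1 fst) /= ->.
rewrite (bigD1 p) /=; last by rewrite neq Ee eqxx.
rewrite (bigD1 (p.2, p.1)) /=; last by rewrite eq_sym neq Ee setUC eqxx.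
rewrite big1 ?addr0 ?mulr2n; first by rewrite [g p.2 _]gC.
move=> q /andP[/andP[/andP[q12 /eqP Eq]] qp qp'].
rewrite Ee in Eq; have := set2_eq q12 Eq; rewrite -!surjective_pairing.
by case=> E; rewrite E eqxx in qp qp'.
Qed.

Lemma card_edges : #|{: edge V}| = 'C(#|V|, 2).
Proof. by rewrite card_sig -card_draws; apply: eq_card => A; rewrite !inE. Qed.

End EdgeSums.

Section Weight.
Variables (R : realType) (m : nat) (V : finType).
Variables (A : V -> V -> {set 'I_(2 * m)}) (kappa theta : R).
Hypotheses (m_gt0 : (0 < m)%N) (AC : forall x y, A x y = A y x).
Hypotheses (kappa_gt0 : 0 < kappa).

(* eps bounds the effect of adding kappa to the cardinalities in a product of
   three of them, and C the loss at a degenerate or incompatible triple. *)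
Let P : R := m.+1%:R ^+ 3.
Let eps : R := kappa * (2 * m).+1%:R ^+ 3.
Hypothesis eps_le : eps <= 2^-1.
Let l : R := ln m.+1%:R.
Let C : R := 3 * ln (2 * m).+1%:R + 1.
(** The logarithm of the factor of a pair in [near_product_card], set to 0 on the diagonal so that
    sums can run over all triples. *)
Let lam x y : R := if x == y then 0 else ln (#|A x y|%:R + kappa).

Let notbig x y := (x != y) && (A x y != big_colors _ m).

Let kappa_le : kappa <= 1.
Proof.
apply: (@le_trans _ _ 2^-1); last by lra.
apply: le_trans eps_le; rewrite -[leLHS]mulr1 ler_wpM2l ?(ltW kappa_gt0) //.
by rewrite exprn_ege1 // ler1n.
Qed.

Let card_le x y : #|A x y|%:R <= (2 * m)%:R :> R.
Proof. by rewrite ler_nat -[leqRHS]card_ord max_card. Qed.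

Let lam_le x y : lam x y <= ln (2 * m).+1%:R.
Proof.
rewrite /lam; case: ifP => _; first by rewrite ln_ge0 // ler1n.
rewrite ler_ln ?posrE ?ltr0n ?ltr_wpDl //.
by rewrite -natr1 lerD.
Qed.

Let lnP : ln P = 3 * l.
Proof. by rewrite /P lnXn ?ltr0n // mulr_natl. Qed.

Let P_ge1 : 1 <= P. Proof. by rewrite exprn_ege1 // ler1n. Qed.
Let l_ge0 : 0 <= l. Proof. by rewrite ln_ge0 // ler1n. Qed.
Let C_ge1 : 1 <= C.
Proof. by rewrite /C lerDr mulr_ge0 // ln_ge0 // ler1n. Qed.
Let eps_ge0 : 0 <= eps.
Proof. by rewrite mulr_ge0 ?exprn_ge0 ?(ltW kappa_gt0). Qed.

(** For a compatible triple of distinct vertices, [compatible_card] bounds the product of the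
    cardinalities by [P], less 1 if [notbig x y]; the shift by [kappa] adds at most [eps], and ln t
    <= t - 1 turns this into the stated bound. For any other triple the term in [C] dominates. *)
Let lam_triple x y z : lam x y + lam x z + lam y z
  <= 3 * l + eps - (notbig x y)%:R / P
   + C * ((incompatible A x y z)%:R + (incompatible A x z y)%:R
         + (incompatible A y z x)%:R
         + (x == y)%:R + (x == z)%:R + (y == z)%:R).
Proof.
have b01 (b : bool) : 0 <= (b%:R : R) <= 1 by case: b; rewrite ?lexx ?ler01.
have [P0 iP] : 0 < P /\ P^-1 <= 1.
  by rewrite invf_le1 ?(lt_le_trans ltr01) // P_ge1.
set s := _ + (y == z)%:R.
have N0 := b01 (notbig x y).
have nbP : (notbig x y)%:R / P <= 1.
  by rewrite ler_pdivrMr // mul1r; apply: le_trans P_ge1; case/andP: N0.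
case: (boolP [|| incompatible A x y z, incompatible A x z y,
    incompatible A y z x, x == y, x == z | y == z]) => [bad|].
  have s1 : 1 <= s.
    rewrite /s -!natrD ler1n.
    by move: bad; do 3![case: (incompatible _ _ _ _)]; do 3![case: (_ == _)].
  have Cs : C <= C * s by rewrite ler_peMr // (le_trans ler01).
  have := lam_le x y; have := lam_le x z; have := lam_le y z.
  have C3 : 3 * ln (2 * m).+1%:R = C - 1 by rewrite /C addrK.
  have := l_ge0; have := eps_ge0; move: Cs C3 nbP; move: (C * s) (_ / P).
  move: C l eps => C' l' eps' u v; lra.
rewrite !negb_or => /and5P[i1 i2 i3 xy /andP[xz yz]].
have -> : s = 0.
  by rewrite /s (negPf i1) (negPf i2) (negPf i3) (negPf xy) (negPf xz) (negPf
    yz) !addr0.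
rewrite mulr0 addr0 /lam (negPf xy) (negPf xz) (negPf yz).
have le_card : (#|A x y| * #|A x z| * #|A y z| + notbig x y <= m.+1 ^ 3)%N.
  apply: leq_trans (compatible_card (A := A x y) (B := A x z) (C :=
    A y z) m_gt0 _).
    rewrite leq_add2l /notbig xy /=.
    by case: (A x y == _); case: (A x z == _); case: (A y z == _).
  move=> a b c aA bA cA; split; rewrite leqNgt; apply/negP => lt.
  - case/negP: i1; apply/existsP; exists a; rewrite aA; apply/existsP; exists b.
    by rewrite bA; apply/existsP; exists c; rewrite cA.
  - case/negP: i2; apply/existsP; exists b; rewrite bA; apply/existsP; exists a.
    by rewrite aA; apply/existsP; exists c; rewrite AC cA.
  - case/negP: i3; apply/existsP; exists c; rewrite cA; apply/existsP; exists a.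
    by rewrite AC aA; apply/existsP; exists b; rewrite AC bA.
have {}le_card : #|A x y|%:R * #|A x z|%:R * #|A y z|%:R + (notbig x y)%:R <= P.
  by rewrite /P -natrX -!natrM -natrD ler_nat.
have k0 := kappa_gt0.
have pos (u v : V) : 0 < #|A u v|%:R + kappa by rewrite ltr_wpDl.
rewrite -lnM ?posrE ?pos // -lnM ?posrE ?mulr_gt0 ?pos //.
set q := _ * _ * _.
have le_q : q <= P - (notbig x y)%:R + eps.
  have := card_le x y; have := card_le x z; have := card_le y z.
  have := ler0n R #|A x y|; have := ler0n R #|A x z|; have := ler0n R #|A y z|.
  move: le_card; rewrite /q /eps -[(2 * m).+1%:R]natr1.
  move: (#|A x y|%:R : R) (#|A x z|%:R : R) (#|A y z|%:R : R) ((2 * m)%:R : R).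
  move=> a b c M le_abc c0 b0 a0 cM bM aM.
  have M0 : 0 <= M by apply: le_trans aM.
  have ab : a * b <= M * M by apply: ler_pM.
  have ac : a * c <= M * M by apply: ler_pM.
  have bc : b * c <= M * M by apply: ler_pM.
  have k2 : kappa * kappa <= kappa by rewrite ler_piMr // ?ltW // kappa_le.
  (* In this expansion the terms with [kappa] are at most kappa (3 M^2 + 3 M + 1), that is, kappa (M
     + 1)^3 - kappa M^3. *)
  have -> : (a + kappa) * (b + kappa) * (c + kappa)
     = a * b * c + kappa * (a * b + a * c + b * c)
       + kappa * kappa * (a + b + c + kappa) by ring.
  have h1 : kappa * (a * b + a * c + b * c) <= kappa * (3 * (M * M)).
    by rewrite ler_pM2l //; lra.
  have h2 : kappa * kappa * (a + b + c + kappa) <= kappa * (3 * M + 1).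
    by apply: ler_pM; rewrite ?mulr_ge0 ?addr_ge0 ?(ltW k0) //; move: kappa_le;
      lra.
  have h3 : 0 <= kappa * M ^+ 3 by rewrite mulr_ge0 ?exprn_ge0 ?(ltW k0).
  rewrite -subr_ge0; have -> : P - (notbig x y)%:R + kappa * (M + 1) ^+ 3 -
    (a * b * c + kappa * (a * b + a * c + b * c) + kappa * kappa * (a + b + c +
      kappa))
    = (P - (a * b * c + (notbig x y)%:R)) + kappa * M ^+ 3
      + (kappa * (3 * (M * M)) - kappa * (a * b + a * c + b * c))
      + (kappa * (3 * M + 1) - kappa * kappa * (a + b + c + kappa)) by ring.
  apply: addr_ge0; last by rewrite subr_ge0.
  apply: addr_ge0; last by rewrite subr_ge0.
  by apply: addr_ge0; rewrite ?subr_ge0.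
have q0 : 0 < q by rewrite !mulr_gt0 ?pos.
have : ln (1 + (q / P - 1)) <= q / P - 1.
  by apply: le_ln1Dx; rewrite ltrBDl subrr divr_gt0.
rewrite addrC subrK ln_div ?posrE // lnP.
have : q / P <= (P - (notbig x y)%:R + eps) / P by rewrite ler_pM2r ?invr_gt0.
rewrite !mulrDl mulNr divff ?gt_eqF //.
have : eps / P <= eps by rewrite ler_piMr.
by lra.
Qed.

Hypothesis inc_le :
  #|[pred t : V * V * V | incompatible A t.1.1 t.1.2 t.2]|%:R
    <= theta * #|V|%:R ^+ 3.

(** Sum [lam_triple] over all ordered triples. Each edge occurs there 6 n times, so dividing by 6 n
    leaves the main term l n^2 / 2, the logarithm of (m + 1)^(n^2 / 2), and a saving of 1 / (6 P)
    for each pair with [notbig]. *)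
Lemma weight_bound : (0 < #|V|)%N ->
  \sum_(e : edge V) ln (#|A (ends e).1 (ends e).2|%:R + kappa)
    <= #|V|%:R ^+ 2 * (l / 2 + eps / 6 + C * theta / 2) + C / 2 * #|V|%:R
      - #|[pred p : V * V | notbig p.1 p.2]|%:R / (6 * P).
Proof.
rewrite -(ltr0n R) => V0; set n : R := #|V|%:R in V0 *.
set W := \sum_(e : edge V) _; set nb := #|[pred p : V * V | _]|%:R.
have lamC x y : lam x y = lam y x by rewrite /lam eq_sym AC.
have E1 : \sum_x \sum_y lam x y = W *+ 2.
  have -> : W = \sum_(e : edge V) lam (ends e).1 (ends e).2.
    by apply: eq_bigr => e _; rewrite /lam (negPf (ends_neq e)).
  rewrite -(sum_edges lamC).
  apply: eq_bigr => x _; rewrite [RHS]big_mkcond; apply: eq_bigr => y _.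
  by rewrite /lam; case: eqP.
have E : \sum_x \sum_y \sum_z (lam x y + lam x z + lam y z) = 6 * n * W.
  rewrite (eq_bigr (fun x => \sum_y n * lam x y + \sum_y n * lam x y
     + \sum_y \sum_z lam y z)); last first.
    move=> x _; rewrite -[X in _ + X + _]mulr_sumr -sum_card -!big_split /=.
    apply: eq_bigr => y _; rewrite !big_split /= sum_card.
    by congr (_ + _ + _).
  rewrite !big_split /= sum_card E1.
  under eq_bigr do rewrite -mulr_sumr; rewrite -mulr_sumr E1 -/n -mulr_natr; ring.
have T1 : \sum_x \sum_y \sum_z (incompatible A x y z)%:R <= theta * n ^+ 3 :> R.
  by rewrite card_triples.
have T2 : \sum_x \sum_y \sum_z (incompatible A x z y)%:R <= theta * n ^+ 3 :> R.
  by under eq_bigr do rewrite exchange_big.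
have T3 : \sum_x \sum_y \sum_z (incompatible A y z x)%:R <= theta * n ^+ 3 :> R.
  by rewrite exchange_big; under eq_bigr do rewrite exchange_big.
have D0 (x : V) : \sum_y (x == y)%:R = 1 :> R.
  by rewrite (bigD1 x) //= eqxx big1 ?addr0 // => y; rewrite eq_sym => /negPf->.
have D1 : \sum_(x : V) \sum_(y : V) \sum_(z : V) (x == y)%:R = n ^+ 2 :> R.
  under eq_bigr do under eq_bigr do rewrite sum_card.
  under eq_bigr do rewrite -mulr_sumr D0.
  by rewrite sum_card -/n; ring.
have D2 : \sum_(x : V) \sum_(y : V) \sum_(z : V) (x == z)%:R = n ^+ 2 :> R.
  under eq_bigr do under eq_bigr do rewrite D0.
  by under eq_bigr do rewrite sum_card; rewrite sum_card -/n; ring.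
have D3 : \sum_(x : V) \sum_(y : V) \sum_(z : V) (y == z)%:R = n ^+ 2 :> R.
  under eq_bigr do under eq_bigr do rewrite D0.
  by under eq_bigr do rewrite sum_card; rewrite sum_card -/n; ring.
have B : \sum_x \sum_y \sum_(z : V) (notbig x y)%:R / P = n * nb / P.
  rewrite /nb -card_pairs mulr_sumr mulr_suml; apply: eq_bigr => x _.
  rewrite mulr_sumr mulr_suml; apply: eq_bigr => y _.
  by rewrite sum_card mulrA.
have : 6 * n * W <= \sum_x \sum_y \sum_z (3 * l + eps - (notbig x y)%:R / P
   + C * ((incompatible A x y z)%:R + (incompatible A x z y)%:R
         + (incompatible A y z x)%:R
         + (x == y)%:R + (x == z)%:R + (y == z)%:R)).
  rewrite -E; apply: ler_sum => x _; apply: ler_sum => y _.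
  by apply: ler_sum => z _; apply: lam_triple.
rewrite (eq_bigr (fun x => \sum_(y : V) \sum_(z : V) (3 * l + eps) -
   \sum_y \sum_(z : V) (notbig x y)%:R / P +
     C * (\sum_y \sum_z (incompatible A x y z)%:R
   + \sum_y \sum_z (incompatible A x z y)%:R +
     \sum_y \sum_z (incompatible A y z x)%:R
   + \sum_y \sum_(z : V) (x == y)%:R + \sum_(y : V) \sum_z (x == z)%:R
   + \sum_(y : V) \sum_z (y == z)%:R))); last first.
  move=> x _; rewrite -sumrB -!big_split /= mulr_sumr -big_split /=.
  apply: eq_bigr => y _.
  by rewrite -sumrB -!big_split /= mulr_sumr -big_split.
rewrite big_split /= sumrB -mulr_sumr !big_split /= B D1 D2 D3 !sum_card -/n.
have C0 : 0 <= C by apply: le_trans C_ge1.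
set t1 := \sum_i _ in T1 *; set t2 := \sum_i _ in T2 *;
  set t3 := \sum_i _ in T3 *.
have : C * (t1 + t2 + t3 + n ^+ 2 + n ^+ 2 + n ^+ 2)
    <= C * (3 * theta * n ^+ 3 + 3 * n ^+ 2) by rewrite ler_wpM2l //; lra.
move=> h1 h2; have {h1 h2} := le_trans h2 (lerD (lexx _) h1).
have -> : n * (n * (n * (3 * l))) + n * (n * (n * eps)) - n * nb / P
    + C * (3 * theta * n ^+ 3 + 3 * n ^+ 2)
   = 6 * n * (n ^+ 2 * (l / 2 + eps / 6 + C * theta / 2) +
     C / 2 * n - nb / (6 * P)).
  by field; rewrite gt_eqF // (lt_le_trans ltr01).
by rewrite ler_pM2l // mulr_gt0.
Qed.

End Weight.

(** * Few small distances *)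

Lemma bin2_real (R : numFieldType) n : 'C(n, 2)%:R = (n%:R ^+ 2 - n%:R) / 2 :> R.
Proof.
elim: n => [|n IH]; first by rewrite expr0n /= subr0 mul0r.
by rewrite binS bin1 natrD IH -natr1; field.
Qed.

Lemma quadratic_dominates (R : archiRealFieldType) (a b c : R) : 0 < a ->
  exists n0 : nat, forall n : nat, (n0 <= n)%N -> b * n%:R + c <= a * n%:R ^+ 2.
Proof.
move=> a0; pose M := (`|b| + `|c|) / a.
have M0 : 0 <= M by rewrite divr_ge0 ?addr_ge0 // ltW.
exists (Num.bound M).+1 => n le_n.
have n1 : 1 <= n%:R :> R by rewrite ler1n (leq_trans _ le_n).
have nM : M <= n%:R.
  apply/ltW/(lt_le_trans (archi_boundP M0)); rewrite ler_nat; exact: ltnW.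
have : a * M * n%:R <= a * n%:R ^+ 2.
  by rewrite expr2 mulrA ler_wpM2r // ler_wpM2l // ltW.
apply: le_trans; rewrite /M mulrC [a * _]mulrC divfK ?gt_eqF // mulrC mulrDl.
apply: lerD; first by rewrite ler_wpM2r // ler_norm.
by apply: le_trans (ler_norm _) _; rewrite ler_peMr.
Qed.

Lemma union_bound (R : realFieldType) (I Q : finType) (B : pred I)
    (P : Q -> pred I) (X : R) :
  (forall i, B i -> exists q, P q i) -> (forall q, #|P q|%:R <= X) ->
  #|B|%:R <= #|Q|%:R * X.
Proof.
move=> BP PX; rewrite -sum_card.
apply: le_trans _ (ler_sum _ (fun q _ => PX q)); rewrite -natr_sum ler_nat.
under eq_bigr do rewrite -sum1_card; rewrite (exchange_big_dep predT) //=.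
rewrite -sum1_card big_mkcond; apply: leq_sum => i _.
case: ifP => // /BP[q Pq]; rewrite (bigD1 q) //=; exact: leq_addr.
Qed.

Definition small (m r : nat) (V : finType) (D : coloring r V) x y :=
  (0 < cdist D x y < m)%N.

Lemma expR_weight (R : realType) (V : finType) m :
  (m.+1%:R ^+ 'C(#|V|, 2)) =
    expR (ln m.+1%:R * ((#|V|%:R ^+ 2 - #|V|%:R) / 2)) :> R.
Proof. by rewrite -bin2_real mulrC expRM_natl lnK // posrE ltr0n. Qed.

(** Union bound over the profiles of [regular_profile]. The colourings close to one profile are
    counted by [near_product_card] and [weight_bound]. Many small distances force many pairs whose
    allowed set is not [big_colors], hence a saving exponential in n^2, against only exp(O(n))
    profiles. *)
Lemma few_small_pairs (R : realType) (m : nat) (delta c : R) :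
    (0 < m)%N -> 0 < delta -> 0 < c ->
  exists n0 : nat, forall V : finType, (n0 <= #|V|)%N ->
  #|[pred D : coloring (2 * m) V | metric D &
      delta * #|V|%:R ^+ 2 <= #|[pred p : V * V | small m D p.1 p.2]|%:R]|%:R
    <= c * m.+1%:R ^+ 'C(#|V|, 2).
Proof.
move=> m0 delta0 c0; set r := (2 * m)%N.
have P1 : 1 <= m.+1%:R ^+ 3 :> R by rewrite exprn_ege1 // ler1n.
have [P PE] : exists P : R, P = m.+1%:R ^+ 3 by exists (m.+1%:R ^+ 3).
rewrite -PE in P1; have P0 : 0 < P by apply: lt_le_trans P1.
have r1 : 1 <= r.+1%:R :> R by rewrite ler1n.
have r0 : 0 < r.+1%:R :> R by apply: lt_le_trans r1.
have lr0 : 0 <= ln r.+1%:R :> R by rewrite ln_ge0.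
have [C CE] : exists C : R, C = 3 * ln r.+1%:R + 1 by eexists.
have C1 : 1 <= C by rewrite CE lerDr mulr_ge0.
(* Then 1 / Z is at most 1 / 2 and at most delta / (8 P), the two bounds required of [eps]. *)
have [Z Z0 ZE] : exists2 Z, 0 < Z & Z = 2 + 8 * P / delta :> R.
  eexists; last reflexivity.
  by rewrite addr_gt0 // divr_gt0 // mulr_gt0.
(* Since exp(-s) <= 1 / s, this makes [eps] at most 1 / Z. *)
have [s s0 sE] : exists2 s, 0 < s & s = r.+1%:R ^+ 4 * Z :> R.
  by eexists; last reflexivity; rewrite mulr_gt0 ?exprn_gt0.
have [kappa k0 kE] : exists2 k, 0 < k & k = expR (- s) * r%:R :> R.
  by eexists; last reflexivity; rewrite mulr_gt0 ?expR_gt0 // ltr0n muln_gt0.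
have [eps epsE] : exists eps : R, eps = kappa * r.+1%:R ^+ 3 by eexists.
have epsZ : eps <= Z^-1.
  have es : expR (- s) <= s^-1.
    rewrite expRN lef_pV2 ?posrE ?expR_gt0 //.
    by apply: le_trans _ (expR_ge1Dx s); rewrite lerDr.
  apply: (@le_trans _ _ (s^-1 * r.+1%:R * r.+1%:R ^+ 3)).
    rewrite epsE kE ler_wpM2r ?exprn_ge0 //.
    by apply: ler_pM; rewrite ?expR_ge0 // ler_nat.
  rewrite sE le_eqVlt; apply/orP; left; apply/eqP; field.
  by rewrite addrC natr1 !gt_eqF.
have eps2 : eps <= 2^-1.
  apply: le_trans epsZ _; rewrite lef_pV2 ?posrE // ZE lerDl.
  by rewrite divr_ge0 ?(ltW delta0) // mulr_ge0 // ltW.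
have epsd : eps <= delta / (8 * P).
  apply: le_trans epsZ _; rewrite -[delta / _]invrK lef_pV2 ?posrE //.
    by rewrite invf_div ZE lerDr.
  by rewrite invr_gt0 divr_gt0 // mulr_gt0.
have s2C : 0 < s + C / 2 + 1.
  by rewrite ltr_wpDl // addr_ge0 ?(ltW s0) // divr_ge0 // (le_trans ler01).
(* Per n^2, the saving is delta / (6 P); [eps] costs at most delta / (48 P), and the terms in
   [theta] cost as much again. More than the delta / (12 P) required below remains. *)
have [theta th0 thE] : exists2 th, 0 < th &
  th * (s + C / 2 + 1) = delta / (48 * P).
  exists (delta / (48 * P) / (s + C / 2 + 1)); last by rewrite divfK ?gt_eqF.
  by rewrite !divr_gt0 // mulr_gt0.
have [K HK] := @regular_profile R r theta th0.
pose T : finType := {ffun 'I_K -> 'I_r.+1}; rewrite -/T in HK.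
have a0 : 0 < delta / (12 * P) by rewrite divr_gt0 // mulr_gt0.
have [n0 Hn0] := quadratic_dominates
  (ln #|{: T}|%:R + C / 2 + ln m.+1%:R / 2)
  (ln #|{: {ffun T * T -> {set 'I_r}}}|%:R - ln c) a0.
exists n0.+1 => V le_n; have V0 : (0 < #|V|)%N by apply: leq_trans le_n.
have {Hn0} := Hn0 _ (ltnW le_n); set n : R := #|V|%:R => Hn0.
pose Q := ({ffun V -> T} * {ffun T * T -> {set 'I_r}})%type.
pose A (q : Q) x y := q.2 (q.1 x, q.1 y).
pose notbig (q : Q) (p : V * V) :=
  (p.1 != p.2) && (A q p.1 p.2 != big_colors r m).
(* At most theta n^2 small pairs are exceptional for the profile of the colouring; every other small
   pair has a small distance in its allowed set, which therefore differs from [big_colors]. *)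
pose good (q : Q) := [&& [forall x, forall y, A q x y == A q y x],
  (#|[pred t : V * V * V |
    incompatible (A q) t.1.1 t.1.2 t.2]|%:R <= theta * n ^+ 3)
  & (delta - theta) * n ^+ 2 <= #|[pred p | notbig q p]|%:R].
pose near (q : Q) (D : coloring r V) :=
  #|[pred e | D e \notin A q (ends e).1 (ends e).2]|%:R <= theta * n ^+ 2.
pose X := expR (s * (theta * n ^+ 2)) * expR (n ^+ 2 * (ln m.+1%:R / 2 + eps / 6
   + C * theta / 2) + C / 2 * n - (delta - theta) * n ^+ 2 / (6 * P)).
apply: (@le_trans _ _ (#|{: Q}|%:R * X)).
  apply: (union_bound (P := fun q D => good q && near q D)).
  - move=> D /andP[metD smallD]; have [tau [B [AC exc inc]]] := HK V D V0 metD.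
    exists (tau, B); rewrite /good /near /A /=; apply/andP; split.
      rewrite inc andTb; apply/andP; split.
        by apply/forallP => x; apply/forallP => y; rewrite AC.
      rewrite mulrBl lerBlDr; apply: le_trans smallD _.
      apply: le_trans _ (lerD (lexx _) exc); rewrite -natrD ler_nat.
      rewrite -cardUI; apply: leq_trans _ (leq_addr _ _).
      apply/subset_leq_card/subsetP => -[x y]; rewrite !inE /= => /andP[xy sm].
      rewrite /notbig /= -(cdist_gt0 D) xy /=.
      case: eqVneq => //= Abig; apply/existsP.
      have [|a Ea] := @cdist_color _ _ D x y; first by rewrite -(cdist_gt0 D).
      by exists a; rewrite Ea eqxx /= -[B _]/(A (tau, B) x y) Abig inE -ltnNge
        -Ea.
    apply: le_trans exc; rewrite ler_nat.
    rewrite -(card_image (@ends_inj V)); apply/subset_leq_card/subsetP => p.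
    case/imageP => e; rewrite !inE => De ->; apply/existsP; exists (D e).
    by rewrite De (cdist_edge D (val_ends e)) eqxx.
  move=> q; case: (boolP (good q)) => [gq|_]; last first.
    by rewrite eq_card0 // mulr_ge0 ?expR_ge0.
  case/and3P: gq => /forallP AC inc nb.
  have {}AC x y : A q x y = A q y x by have /forallP/(_ y)/eqP := AC x.
  apply: le_trans (near_product_card (fun e => A q (ends e).1 (ends e).2)
     (theta * n ^+ 2) (ltW s0)) _.
  rewrite ler_wpM2l ?expR_ge0 // card_ord -kE prod_expR_ln => [|e]; last first.
    by rewrite ltr_wpDl.
  rewrite ler_expR; have := @weight_bound R m V (A q) kappa theta m0 AC k0.
  rewrite -epsE => /(_ eps2 inc V0)/le_trans; apply.
  rewrite -CE -PE lerD2l lerN2 ler_wpM2r // invr_ge0 mulr_ge0 // ltW //.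
have Q0 : (0 < #|{: Q}|)%N.
  by apply/card_gt0P; exists ([ffun=> [ffun=> ord0]], [ffun=> set0]).
have N0 : (0 < #|{: T}|)%N by apply/card_gt0P; exists [ffun=> ord0].
have N1 : (0 < #|{: {ffun T * T -> {set 'I_r}}}|)%N.
  by apply/card_gt0P; exists [ffun=> set0].
have QE : #|{: Q}|%:R = expR (n * ln #|{: T}|%:R
    + ln #|{: {ffun T * T -> {set 'I_r}}}|%:R) :> R.
  rewrite expRD expRM_natl !lnK ?posrE ?ltr0n // card_prod natrM.
  by rewrite [in LHS]card_ffun natrX.
rewrite QE /X -!expRD expR_weight -[c]lnK ?posrE // -expRD ler_expR -/n.
move: Hn0; set lT := ln #|{: T}|%:R; set lm := ln m.+1%:R; set lQ := ln _%:R.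
move=> Hn0.
have E1 : n ^+ 2 * (theta * (s + C / 2 + 1)) =
  n ^+ 2 * (delta / (48 * P)) by rewrite thE.
have E2 : n ^+ 2 * eps <=
  n ^+ 2 * (delta / (8 * P)) by rewrite ler_wpM2l ?exprn_ge0.
have E3 : theta * n ^+ 2 / (6 * P) <= theta * n ^+ 2.
  rewrite ler_piMr ?mulr_ge0 ?exprn_ge0 ?(ltW th0) //.
  by rewrite invf_le1 ?mulr_gt0 //; move: P1; lra.
have -> : (delta - theta) * n ^+ 2 / (6 * P)
  = delta / (6 * P) * n ^+ 2 - theta * n ^+ 2 / (6 * P).
  by field; rewrite gt_eqF.
have E4 : delta / (12 * P) = delta / P / 12 by field; rewrite gt_eqF.
have E5 : delta / (48 * P) = delta / P / 48 by field; rewrite gt_eqF.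
have E6 : delta / (8 * P) = delta / P / 8 by field; rewrite gt_eqF.
have E7 : delta / (6 * P) = delta / P / 6 by field; rewrite gt_eqF.
rewrite E4 in Hn0; rewrite E5 in E1; rewrite E6 in E2; rewrite E7.
have E8 : 0 <= n ^+ 2 * (delta / P) by rewrite mulr_ge0 ?exprn_ge0 // divr_ge0
  ?ltW.
move: Hn0 E1 E2 E3 E8; move: (theta * n ^+ 2 / _) (delta / P) => u v.
lra.
Qed.

(** * Vertices with many small distances *)

Lemma expRN_small (R : realType) (x eps : R) : 0 <= x -> 0 < eps ->
  exists2 s, 0 < s & expR (- s) * x <= eps.
Proof.
move=> x0 e0; exists (x / eps + 1); first by rewrite ltr_wpDl // divr_ge0 // ltW.
rewrite expRN mulrC ler_pdivrMr ?expR_gt0 //.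
rewrite -ler_pdivrMl // mulrC; apply: le_trans _ (expR_ge1Dx _).
by rewrite addrCA lerDl addr_ge0.
Qed.

Lemma card_edges_in (V : finType) (N : {set V}) :
  #|[pred e : edge V | val e \subset N]| = 'C(#|N|, 2).
Proof.
rewrite -cards_draws -(card_imset _ val_inj); apply: eq_card => B.
rewrite !inE; apply/imsetP/andP => [[e]|[BN B2]].
  by case: e => e e2 /=; rewrite inE => eN ->.
by exists (exist (fun A : {set V} => #|A| == 2%N) B B2); rewrite ?inE.
Qed.

Lemma card_middle_colors m : (1 < m)%N ->
  (#|[set i : 'I_(2 * m) | m <= i.+1 <= (2 * m).-2]| <= m.-1)%N.
Proof.
move=> m1; have -> : m.-1 = ((2 * m).-2.-1 - m.-1 + 1)%N by lia.
by apply: interval_card => [i|]; rewrite ?inE; lia.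
Qed.

(** Let N be the set of vertices at distance below m from x. Distances inside N are at most 2m - 2,
    so apart from the few small ones they take at most m - 1 values instead of m + 1. This saves a
    factor exponential in n^2, against 2^n choices of N. *)
Lemma few_small_degrees (R : realType) (m : nat) (delta' : R) :
    (1 < m)%N -> 0 < delta' ->
  exists2 delta : R, 0 < delta & forall c : R, 0 < c ->
  exists n0 : nat, forall V : finType, (n0 <= #|V|)%N ->
  #|[pred D : coloring (2 * m) V | [&& metric D,
      #|[pred p : V * V | small m D p.1 p.2]|%:R <= delta * #|V|%:R ^+ 2 &
      [exists x, delta' * #|V|%:R <= #|[pred y | small m D x y]|%:R]]]|%:R
    <= c * m.+1%:R ^+ 'C(#|V|, 2).
Proof.
move=> m1 d0; have m0 : (0 < m)%N by apply: ltnW.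
have [g g0 gE] : exists2 g : R, 0 < g & ln m%:R = ln m.+1%:R - g.
  exists (ln m.+1%:R - ln m%:R); last by rewrite opprB addrC subrK.
  by rewrite subr_gt0 ltr_ln ?posrE ?ltr0n // ltr_nat.
(* The saving is about g delta'^2 n^2 / 2 = 4 a n^2. The small pairs cost s delta n^2 = a n^2 and
   [kappa] at most a n^2, leaving 2 a n^2. *)
have [a a0 aE] : exists2 a : R, 0 < a & a = g * delta' ^+ 2 / 8.
  by eexists; last reflexivity; rewrite divr_gt0 ?mulr_gt0 ?exprn_gt0.
have [s s0 sle] := @expRN_small R (2 * m)%:R (Num.min 1 (2 * a)) (ler0n _ _)
   ltac:(by rewrite lt_min ltr01 mulr_gt0).
move: sle; set kappa := expR (- s) * _; rewrite le_min => /andP[k1 ka].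
have k0 : 0 < kappa by rewrite mulr_gt0 ?expR_gt0 // ltr0n muln_gt0.
exists (a / s); first exact: divr_gt0.
move=> c c0; have a2 : 0 < 2 * a by rewrite mulr_gt0.
have [n0 Hn0] := quadratic_dominates (ln 2 + g / 2) (- ln c) a2.
exists n0 => V /Hn0; set n : R := #|V|%:R => {}Hn0.
pose mid := [set i : 'I_(2 * m) | (m <= i.+1 <= (2 * m).-2)%N].
pose inside (N : {set V}) (e : edge V) := val e \subset N.
pose A N e := if inside N e then mid else big_colors (2 * m) m.
pose X := expR (s * (a / s * n ^+ 2)) * expR ((n ^+ 2 - n) / 2 * (ln m.+1%:R +
  kappa)
   - g * ((delta' ^+ 2 * n ^+ 2 - n) / 2)).
pose near N (D : coloring (2 * m) V) :=
  #|[pred e | D e \notin A N e]|%:R <= a / s * n ^+ 2.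
apply: (@le_trans _ _ (#|{: {set V}}|%:R * X)).
  apply: (@union_bound R (coloring (2 * m) V) {set V} _
    (fun N D => (delta' * n <= #|N|%:R) && near N D)).
  - move=> D /and3P[/metricP metD smallD /existsP[x xN]].
    exists [set y | small m D x y]; apply/andP; split.
      by apply: le_trans xN _; rewrite ler_nat;
        apply/subset_leq_card/subsetP => y; rewrite !inE.
    apply: le_trans smallD; rewrite ler_nat -(card_image (@ends_inj V)).
    apply/subset_leq_card/subsetP => p /imageP[e]; rewrite !inE => De ->.
    have Ee := cdist_edge D (val_ends e).
    rewrite /small Ee; apply: contraR De; rewrite /= -leqNgt => le_m.
    rewrite /A /inside; case: ifP => [|_]; rewrite inE // le_m /=.
    rewrite val_ends subUset !sub1set !inE => /andP[/andP[_ lt1] /andP[_ lt2]].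
    have := metD (ends e).1 x (ends e).2; rewrite Ee [cdist D _ x]cdistC.
    by move: lt1 lt2 m1; clear; lia.
  move=> N; case: (lerP (delta' * n) _) => [le_N|_]; last first.
    by rewrite eq_card0 // mulr_ge0 ?expR_ge0.
  apply: le_trans (near_product_card (A N) (a / s * n ^+ 2) (ltW s0)) _.
  rewrite ler_wpM2l ?expR_ge0 // card_ord -/kappa prod_expR_ln => [|e];
    last first.
    by rewrite ltr_wpDl.
  rewrite ler_expR.
  have le_e (e : edge V) : ln (#|A N e|%:R + kappa)
      <= ln m.+1%:R + kappa - g * (inside N e)%:R.
    rewrite /A; case: ifP => _.
      apply: (@le_trans _ _ (ln m%:R)).
        rewrite ler_ln ?posrE ?ltr0n ?ltr_wpDl //.
        have le_mid : (#|mid| <= m.-1)%N.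
          exact: card_middle_colors.
        have -> : m%:R = m.-1%:R + 1 :> R by rewrite natr1 prednK.
        by rewrite lerD // ler_nat.
      by rewrite gE mulr1 lerD2r lerDl ltW.
    rewrite mulr0 subr0 card_big_colors //.
    have M0 : 0 < m.+1%:R :> R by rewrite ltr0n.
    have -> : m.+1%:R + kappa = m.+1%:R * (1 + kappa / m.+1%:R).
      by rewrite mulrDr mulr1 mulrC divfK ?gt_eqF.
    have k'0 : 0 < kappa / m.+1%:R by rewrite divr_gt0.
    rewrite lnM ?posrE ?addr_gt0 // lerD2l.
    apply: le_trans (le_ln1Dx _) _; first exact: lt_trans (ltrN10 _) k'0.
    by rewrite ler_pdivrMr // ler_peMr ?(ltW k0) // ler1n.
  apply: le_trans (ler_sum _ (fun e _ => le_e e)) _.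
  rewrite sumrB sum_card -mulr_sumr.
  have -> : \sum_(e : edge V) (inside N e)%:R = 'C(#|N|, 2)%:R :> R.
    rewrite -card_edges_in -sum1_card natr_sum [RHS]big_mkcond.
    by apply: eq_bigr => e _; rewrite inE /inside; case: (_ \subset _).
  rewrite card_edges !bin2_real -/n lerD2l lerN2 ler_pM2l // ler_pM2r ?invr_gt0
    //.
  have le_n : #|N|%:R <= n by rewrite ler_nat max_card.
  rewrite lerD ?lerN2 // -exprMn lerXn2r ?nnegrE ?mulr_ge0 //.
  exact: ltW.
have setE : #|{: {set V}}|%:R = expR (n * ln 2) :> R.
  by rewrite -cardsT -powersetT card_powerset cardsT natrX expRM_natl lnK ?posrE.
rewrite setE /X -!expRD expR_weight -[c]lnK ?posrE // -expRD ler_expR -/n.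
have -> : s * (a / s * n ^+ 2) = a * n ^+ 2 by field; rewrite gt_eqF.
have n00 : 0 <= n by [].
have E1 : n ^+ 2 * kappa <= n ^+ 2 * (2 * a) by rewrite ler_wpM2l ?exprn_ge0.
have E2 : g * ((delta' ^+ 2 * n ^+ 2 - n) / 2) = 4 * a * n ^+ 2 - g / 2 * n.
  by rewrite aE; field.
have E3 : 0 <= n * kappa by rewrite mulr_ge0 // ltW.
rewrite E2; lra.
Qed.

(** * Removing two vertices at a small distance *)

Lemma linear_dominates (R : archiRealFieldType) (a c : R) : 0 < a ->
  exists n0 : nat, forall n : nat, (n0 <= n)%N -> c <= a * n%:R.
Proof.
move=> a0; exists (Num.bound (`|c| / a)) => n le_n.
apply: le_trans (ler_norm c) _; rewrite mulrC -ler_pdivrMr //.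
have ca0 : 0 <= `|c| / a by rewrite divr_ge0 // ltW.
by apply/ltW/(lt_le_trans (archi_boundP ca0)); rewrite ler_nat.
Qed.

Section Pullback.
Variables (r : nat) (U V : finType) (f : U -> V).
Hypothesis f_inj : injective f.
Local Open Scope nat_scope.

Lemma image_edge_proof (e : edge U) : #|f @: val e| == 2.
Proof. by rewrite card_imset //; case: e. Qed.

Definition image_edge (e : edge U) : edge V :=
  exist (fun A : {set V} => #|A| == 2) _ (image_edge_proof e).

Definition pullback (D : coloring r V) : coloring r U :=
  [ffun e => D (image_edge e)].

Lemma cdist_pullback D x y : cdist (pullback D) x y = cdist D (f x) (f y).
Proof.
case: (eqVneq x y) => [->|xy]; first by rewrite !cdistxx.
have [e _ Ee] := insub_pairP xy.
have Ee' : val (image_edge e) = [set f x; f y].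
  by rewrite /= Ee imsetU1 imset_set1.
by rewrite (cdist_edge _ Ee) (cdist_edge _ Ee') ffunE.
Qed.

Lemma metric_pullback D : metric D -> metric (pullback D).
Proof. by move=> /metricP mD; apply/metricP => x y z;
  rewrite !cdist_pullback. Qed.

End Pullback.

Lemma cdist_inj r (V : finType) (D D' : coloring r V) :
  (forall x y, cdist D x y = cdist D' x y) -> D = D'.
Proof.
move=> E; apply/ffunP => e; apply: val_inj.
by have := E (ends e).1 (ends e).2; rewrite !(cdist_edge _ (val_ends e)) => -[].
Qed.

Section TwoPoints.
Variables (r n : nat) (x y : 'I_n.+2).
Hypothesis xy : x != y.

Lemma exists_avoid : exists2 f : 'I_n -> 'I_n.+2, injective f &
  (forall u, f u != x /\ f u != y) /\
  (forall z, z != x -> z != y -> exists u, z = f u).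
Proof.
have [y' Ey _] := unlift_some xy; exists (fun u => lift x (lift y' u)).
  by move=> u v /lift_inj /lift_inj.
split=> [u|z zx zy].
  by rewrite Ey eq_sym neq_lift (inj_eq lift_inj) eq_sym neq_lift.
have xz : x != z by rewrite eq_sym.
have [z' Ez _] := unlift_some xz.
have yz : y' != z' by apply: contraNneq zy => E; rewrite Ez Ey E.
by have [u Eu _] := unlift_some yz; exists u; rewrite Ez Eu.
Qed.

End TwoPoints.

Lemma card_close_colors m : (0 < m)%N ->
  (#|[set p : 'I_(2 * m) * 'I_(2 * m) | [&& m <= p.1.+1, m <= p.2.+1,
      p.1 < p.2 + m & p.2 < p.1 + m]]| < m.+1 ^ 2)%N.
Proof.
move=> m0; have Ec : #|finset.setX (big_colors (2 * m) m) (big_colors (2 * m) m)|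
   = (m.+1 ^ 2)%N by rewrite cardsX card_big_colors.
rewrite -Ec; apply: proper_card; apply/properP; split.
  by apply/subsetP => p; rewrite !inE => /and4P[-> ->].
(* The distances m and 2m differ by m and so are not close. *)
have lt1 : (m.-1 < 2 * m)%N by lia.
have lt2 : ((2 * m).-1 < 2 * m)%N by lia.
exists (Ordinal lt1, Ordinal lt2); rewrite !inE /=; lia.
Qed.

(** Delete x and y with d(x, y) < m. The colouring is determined by its restriction, the pairs (d(x,
    u), d(y, u)) and d(x, y). All but 2 delta (n + 2) of these pairs are close, leaving at most (m +
    1)^2 - 1 choices each; this exponential saving beats the number of choices of x and y. *)
Lemma rare_small_pair (R : realType) (m : nat) : (0 < m)%N ->
  exists2 delta : R, 0 < delta & forall c : R, 0 < c ->
  exists n0 : nat, forall n, (n0 <= n)%N ->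
  #|[pred D : coloring (2 * m) 'I_n.+2 | [&& metric D,
      [forall x, #|[pred y | small m D x y]|%:R <= delta * n.+2%:R] &
      [exists x, exists y, small m D x y]]]|%:R
    <= c * m.+1%:R ^+ (2 * n).+1
       * #|[pred D : coloring (2 * m) 'I_n | metric D]|%:R.
Proof.
move=> m0.
pose M2 : R := m.+1%:R ^+ 2.
have M21 : 1 <= M2 by rewrite exprn_ege1 // ler1n.
(* The saving per vertex: [kappa] is at most 1 / 2, so [M2] - 1 + [kappa] is at most [M2] - 1 /
   2. *)
have [g g0 gE] : exists2 g : R, 0 < g & ln (M2 - 2^-1) = ln M2 - g.
  exists (ln M2 - ln (M2 - 2^-1)); last by rewrite opprB addrCA subrr addr0.
  rewrite subr_gt0 ltr_ln ?posrE; move: M21; lra.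
have [s s0 sle] := @expRN_small R #|{: 'I_(2 * m) * 'I_(2 * m)}|%:R 2^-1 (ler0n
  _ _)
   ltac:(by rewrite invr_gt0).
move: sle; set kappa := expR (- s) * _ => k2.
have k0 : 0 < kappa.
  rewrite mulr_gt0 ?expR_gt0 // ltr0n card_prod card_ord muln_gt0 andbb.
  by rewrite muln_gt0.
have s20 : 0 < 16 * s by rewrite mulr_gt0.
exists (g / (16 * s)) => [|c c0]; first exact: divr_gt0.
set delta := g / (16 * s).
pose r := (2 * m)%N; have r0 : 0 < r%:R :> R by rewrite ltr0n muln_gt0.
have e80 : 0 < g / 8 by rewrite divr_gt0.
(* The quadratic term of the exponential series gives (n + 2)^2 <= h exp (g (n + 2) / 8). The
   exceptional vertices cost another g (n + 2) / 8, by the choice of [delta]. *)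
have [h h0 hE] : exists2 h : R, 0 < h & h = 2 / (g / 8) ^+ 2.
  by eexists; last reflexivity; rewrite divr_gt0 // exprn_gt0.
have g20 : 0 < g / 2 by rewrite divr_gt0.
have [n0 Hn0] := linear_dominates (ln (h * r%:R) + g / 2 - ln c) g20.
exists n0.+1 => n le_n; set f := #|[pred D | metric D]|%:R.
pose close := [set p : 'I_(2 * m) * 'I_(2 * m) | [&& (m <= p.1.+1)%N,
   (m <= p.2.+1)%N, (p.1 < p.2 + m)%N & (p.2 < p.1 + m)%N]].
pose k : R := 2 * delta * n.+2%:R.
pose rows := [pred F : {ffun 'I_n -> 'I_r * 'I_r} |
  #|[pred u | F u \notin close]|%:R <= k].
pose X := f * #|rows|%:R * r%:R.
apply: (@le_trans _ _ (#|{: 'I_n.+2 * 'I_n.+2}|%:R * X)).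
  pose P (q : 'I_n.+2 * 'I_n.+2) (D : coloring (2 * m) 'I_n.+2) :=
    [&& metric D, [forall x, #|[pred y | small m D x y]|%:R <= delta * n.+2%:R] &
      small m D q.1 q.2].
  apply: (@union_bound R _ _ _ P).
    move=> D /and3P[mD dD /existsP[x /existsP[y sD]]].
    by exists (x, y); apply/and3P.
  move=> [x y]; case: (eqVneq x y) => [->|xy].
    rewrite eq_card0 => [|D]; first by rewrite /X !mulr_ge0.
    by apply/negP => /and3P[_ _]; rewrite /small cdistxx.
  have [i i_inj [iN iS]] := exists_avoid xy.
  have c1 : 'I_r by exists 0%N; rewrite muln_gt0.
  pose col (D : coloring r 'I_n.+2) (u v : 'I_n.+2) : 'I_r :=
    oapp D c1 (insub [set u; v]).
  have colE D u v : u != v -> cdist D u v = (col D u v).+1.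
    by rewrite /cdist /col => /insub_pairP[e -> _].
  pose enc D := (pullback i_inj D, [ffun u =>
    (col D x (i u), col D y (i u))], col D x y).
  have enc_inj : injective enc.
    move=> D D' [E1 E2 E3]; apply: cdist_inj => u v.
    have Exy : cdist D x y = cdist D' x y by rewrite !colE // E3.
    have Ex t : cdist D x (i t) = cdist D' x (i t).
      have [ix iy] := iN t; rewrite !colE 1?eq_sym //.
      by move/ffunP/(_ t): E2; rewrite !ffunE => -[-> _].
    have Ey t : cdist D y (i t) = cdist D' y (i t).
      have [ix iy] := iN t; rewrite !colE 1?eq_sym //.
      by move/ffunP/(_ t): E2; rewrite !ffunE => -[_ ->].
    have Ei t t' : cdist D (i t) (i t') = cdist D' (i t) (i t').
      by rewrite -!(cdist_pullback i_inj) E1.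
    case: (eqVneq u x) => [->|ux]; case: (eqVneq v x) => [->|vx];
      try case: (eqVneq u y) => [->|uy]; try case: (eqVneq v y) => [->|vy];
      rewrite ?cdistxx // ?Exy // 1?[cdist _ y x]cdistC ?[cdist D' y x]cdistC
        ?Exy //.
    - by have [t ->] := iS _ vx vy; rewrite Ex.
    - by have [t ->] := iS _ ux uy; rewrite ![cdist _ _ x]cdistC Ex.
    - by have [t ->] := iS _ vx vy; rewrite Ey.
    - by have [t ->] := iS _ ux uy; rewrite ![cdist _ _ y]cdistC Ey.
    - by have [t ->] := iS _ vx vy; have [t' ->] := iS _ ux uy; apply: Ei.
  have -> : X = #|[pred t : coloring r 'I_n * {ffun 'I_n -> 'I_r * 'I_r}
      * 'I_r | metric t.1.1 && rows t.1.2]|%:R.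
    rewrite /X /f -!natrM; congr _%:R.
    rewrite -[X in (_ * X)%N](card_ord r) -!cardX; apply: eq_card => t.
    by rewrite !inE andbT.
  rewrite ler_nat -(card_image enc_inj).
  apply/subset_leq_card/subsetP => _ /imageP[D + ->].
  rewrite !inE /enc /= /P /= => /and3P[mD /forallP dD sD].
  rewrite metric_pullback //=.
  (* If u is at distance at least m from x and y, these distances differ by at most d(x, y) < m, so
     the pair of u is close. *)
  apply: (@le_trans _ _ (#|[pred u | small m D x u]|%:R + #|[pred u |
    small m D y u]|%:R)); last first.
    rewrite /k -mulrA mulr_natl mulr2n; apply: lerD; exact: dD.
  rewrite -natrD ler_nat -cardUI; apply: leq_trans _ (leq_addr _ _).
  rewrite -(card_image i_inj); apply/subset_leq_card/subsetP => _ /imageP[u + ->].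
  have [ix iy] := iN u.
  rewrite !inE ffunE /small /= !colE 1?eq_sym // => far.
  move: sD; rewrite /small => /andP[_ lt_m].
  have /metricP mD' := mD.
  have := mD' x y (i u); have := mD' y x (i u); rewrite [cdist D y x]cdistC.
  rewrite (colE _ x (i u)) 1?eq_sym // (colE _ y (i u)) 1?eq_sym //.
  move: far lt_m; move: (nat_of_ord (col D x (i u))) (nat_of_ord (col D y (i u))).
  by move: (cdist D x y); clear; lia.
have n2 : n.+2%:R = n%:R + 2 :> R by rewrite -addn2 natrD.
have rows_le : #|rows|%:R <= expR (s * k) * expR ((ln M2 - g) * n%:R).
  apply: le_trans (near_product_card (fun=> close) k (ltW s0)) _.
  rewrite ler_wpM2l ?expR_ge0 // prodr_const card_ord expRM_natr lerXn2r //;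
    rewrite ?nnegrE ?expR_ge0 ?addr_ge0 ?(ltW k0) //.
  rewrite -gE lnK; last by rewrite posrE; move: M21; lra.
  have : #|close|%:R <= M2 - 1.
    by rewrite lerBrDr /M2 -natrX natr1 ler_nat; apply: card_close_colors.
  by move: k2; rewrite -/kappa; lra.
have n22 : n.+2%:R ^+ 2 <= h * expR (g / 8 * n.+2%:R).
  rewrite hE -ler_pdivrMl ?divr_gt0 ?exprn_gt0 //.
  apply: (@le_trans _ _ (1 + (g / 8 * n.+2%:R) ^+ 2 / 2`!%:R)).
    have -> : (2 / (g / 8) ^+ 2)^-1 * n.+2%:R ^+ 2
        = (g / 8 * n.+2%:R) ^+ 2 / 2`!%:R :> R.
      have -> : 2`!%:R = 2 :> R by rewrite !factS fact0.
      by field; rewrite gt_eqF.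
    by rewrite lerDr.
  by apply: expR_ge1Dxn; rewrite mulr_ge0 // ltW.
rewrite /X card_prod !card_ord natrM.
have -> : n.+2%:R * n.+2%:R * (f * #|rows|%:R * r%:R)
  = f * r%:R * (n.+2%:R ^+ 2 * #|rows|%:R) by rewrite expr2; ring.
have f0 : 0 <= f by [].
have : n.+2%:R ^+ 2 * #|rows|%:R <= h * expR (g / 8 * n.+2%:R)
   * (expR (s * k) * expR ((ln M2 - g) * n%:R)).
  by apply: ler_pM; rewrite ?exprn_ge0.
move=> /(ler_wpM2l (mulr_ge0 f0 (ltW r0)))/le_trans; apply.
have -> : c * m.+1%:R ^+ (2 * n).+1 * f = f * (c * (m.+1%:R * M2 ^+ n)).
  by rewrite /M2 -exprM exprS; ring.
rewrite -mulrA ler_wpM2l //.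
apply: (@le_trans _ _ (c * M2 ^+ n)); last first.
  rewrite ler_wpM2l ?(ltW c0) // ler_peMl ?exprn_ge0 ?(le_trans ler01 M21) //.
  by rewrite ler1n.
rewrite -[h * _ * _]mulrA [r%:R * (h * _)]mulrA [r%:R * h]mulrC.
have M20 : 0 < M2 by apply: lt_le_trans M21.
have -> : c * M2 ^+ n = expR (ln c + ln M2 * n%:R).
  by rewrite expRD expRM_natr !lnK ?posrE.
have hr0 : 0 < h * r%:R by apply: mulr_gt0.
rewrite -[h * r%:R]lnK ?posrE // -!expRD ler_expR.
have -> : s * k = g / 8 * n.+2%:R.
  by rewrite /k /delta; field; rewrite gt_eqF.
have := Hn0 n (ltnW le_n).
rewrite n2 => Hn; have gn0 : 0 <= g * n%:R by rewrite mulr_ge0 // ltW.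
move: Hn gn0; move: (n%:R : R) (ln M2) (ln (h * r%:R)) (ln c) => N a b d; lra.
Qed.

(** * Almost all distances are large *)

Definition all_big (m : nat) (V : finType) (D : coloring (2 * m) V) :=
  [forall e, D e \in big_colors (2 * m) m].

Lemma card_all_big (m : nat) (V : finType) : (0 < m)%N ->
  #|[pred D : coloring (2 * m) V | all_big D]| = (m.+1 ^ 'C(#|V|, 2))%N.
Proof.
move=> m0; rewrite -(card_big_colors m0) -card_edges -card_ffun_on.
by apply: eq_card => D; rewrite !inE; apply/forallP/ffun_onP.
Qed.

Lemma all_bigP m (V : finType) (D : coloring (2 * m) V) :
  reflect (forall x y, x != y -> (m <= cdist D x y)%N) (all_big D).
Proof.
apply: (iffP forallP) => [Db x y xy|Db e].
  have [e _ Ee] := insub_pairP xy.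
  by rewrite (cdist_edge D Ee); have := Db e; rewrite inE.
by rewrite inE -(cdist_edge D (val_ends e)) Db // ends_neq.
Qed.

Lemma all_big_metric m (V : finType) (D : coloring (2 * m) V) :
  all_big D -> metric D.
Proof.
move=> /all_bigP Db; apply/metricP => x y z.
case: (eqVneq x y) => [->|xy]; first by rewrite cdistxx.
case: (eqVneq y z) => [->|yz]; first by rewrite cdistxx addn0.
by apply: leq_trans (cdist_le _ _ _) _; have := Db _ _ xy; have := Db _ _ yz; lia.
Qed.

Lemma not_all_big m (V : finType) (D : coloring (2 * m) V) :
  ~~ all_big D -> [exists x, exists y, small m D x y].
Proof.
rewrite negb_forall => /existsP[e]; rewrite inE -ltnNge => lt_m.
apply/existsP; exists (ends e).1; apply/existsP; exists (ends e).2.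
by rewrite /small (cdist_edge D (val_ends e)).
Qed.

Lemma card_predU_le (T : finType) (A B : pred T) :
  (#|[pred x | A x || B x]| <= #|A| + #|B|)%N.
Proof. by rewrite -cardUI -[leqLHS]addn0 leq_add. Qed.

Section Recursion.
Variables (R : realType) (m : nat).
Hypothesis m1 : (1 < m)%N.

Let f n : R := #|[pred D : coloring (2 * m) 'I_n | metric D]|%:R.
Let b n : R :=
  #|[pred D : coloring (2 * m) 'I_n | metric D & ~~ all_big D]|%:R.
Let F n : R := m.+1%:R ^+ 'C(n, 2).

Let F_gt0 n : 0 < F n. Proof. by rewrite exprn_gt0. Qed.

Let fE n : f n = F n + b n.
Proof.
rewrite /f /F /b -natrX -[n in 'C(n, _)]card_ord -(card_all_big _ (ltnW m1)).
rewrite -natrD; congr _%:R; rewrite -[LHS](cardID [pred D | all_big D]).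
congr (_ + _)%N; apply: eq_card => D; rewrite !inE; last by rewrite andbC.
by apply/andb_idl; apply: all_big_metric.
Qed.

Let FSS n : F n.+2 = m.+1%:R ^+ (2 * n).+1 * F n.
Proof.
rewrite /F -exprD; congr (_ ^+ _).
by rewrite !binS !bin1 bin0; lia.
Qed.

(** A colouring with a small distance has many small pairs, or few but a vertex in many of them, or
    no such vertex. The thresholds are chosen in reverse order, each depending on the next case. *)
Let bad_step (c : R) : 0 < c -> exists n0, forall n, (n0 <= n)%N ->
  b n.+2 <= c * F n.+2 + c * m.+1%:R ^+ (2 * n).+1 * f n.
Proof.
move=> c0; have [d' d'0 H3] := rare_small_pair R (ltnW m1).
have [d d0 H2] := few_small_degrees m1 d'0.
have c20 : 0 < c / 2 by rewrite divr_gt0.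
have [n1 N1] := few_small_pairs (ltnW m1) d0 c20.
have [n2 N2] := H2 _ c20; have [n3 N3] := H3 _ c0.
exists (n1 + n2 + n3)%N => n le_n.
have [le1 le2 le3] : [/\ n1 <= n.+2, n2 <= n.+2 & n3 <= n]%N.
  by move: le_n; clear => le_n; split; lia.
have {}N1 := N1 'I_n.+2; have {}N2 := N2 'I_n.+2; rewrite card_ord in N1 N2.
have {le1}N1 := N1 le1; have {le2}N2 := N2 le2; have {le3}N3 := N3 _ le3.
have cF : c * F n.+2 = c / 2 * F n.+2 + c / 2 * F n.+2.
  by rewrite -mulrDl -splitr.
rewrite cF; apply: le_trans (lerD (lerD N1 N2) N3).
rewrite -!natrD ler_nat.
apply: leq_trans (leq_add (card_predU_le _ _) (leqnn _)).
apply: leq_trans (card_predU_le _ _).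
apply/subset_leq_card/subsetP => D; rewrite !inE => /andP[mD /not_all_big sD].
rewrite mD sD /=.
case: lerP => //= /ltW le_d; rewrite le_d /= andbT.
case: existsP => //= noN; apply/forallP => x.
by rewrite leNgt; apply/negP => /ltW le_x; apply: noN; exists x.
Qed.

(** Induction in steps of two. With c = 1 / 4, the bound G passes to 1 + 1 / 4 + G / 4, which is at
    most G since G >= 2; the finite sum in [G] covers the initial values. *)
Let bounded : exists2 G, 0 < G & forall n, f n <= G * F n.
Proof.
have [n0 Hn0] := bad_step (c := 4^-1) ltac:(by rewrite invr_gt0).
exists (2 + \sum_(i < n0.+2) f i).
  by rewrite ltr_pwDl // sumr_ge0.
set G := 2 + _; have G2 : 2 <= G by rewrite lerDl sumr_ge0.
elim/ltn_ind=> n IH; have [lt_n|le_n] := ltnP n n0.+2.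
  apply: (@le_trans _ _ G).
    rewrite /G (bigD1 (Ordinal lt_n)) //= addrCA lerDl addr_ge0 // sumr_ge0 //.
  by rewrite ler_peMr ?(le_trans _ G2) // exprn_ege1 // ler1n.
case: n le_n IH => [|[|n]] // le_n IH.
have {}le_n : (n0 <= n)%N by lia.
have := Hn0 n le_n; have := IH n ltac:(lia); rewrite [f n.+2]fE FSS.
set M := m.+1%:R ^+ _ => le_f.
have M0 : 0 < M by rewrite exprn_gt0.
have := ler_wpM2l (ltW M0) le_f; have := F_gt0 n.
move: (f n) (F n) (b n.+2) => u v w v0 h1 h2.
have h3 : 0 <= M * v * (G - 2) by rewrite mulr_ge0 ?subr_ge0 // mulr_ge0 // ltW.
move: h1 h2 h3; have := mulr_gt0 M0 v0; lra.
Qed.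

(** The crude bound [bounded] is fed back into [bad_step], whose two terms then add up to c F(n). *)
Lemma mostly_all_big (c : R) : 0 < c ->
  exists n0, forall n, (n0 <= n)%N -> b n <= c * F n.
Proof.
move=> c0; have [G G0 fG] := bounded.
have e0 : 0 < c / (1 + G) by rewrite divr_gt0 // addr_gt0.
have [n0 Hn0] := bad_step e0; exists n0.+2 => -[|[|n]] // le_n.
apply: le_trans (Hn0 n le_n) _.
set e := c / _; set M := m.+1%:R ^+ _.
have eM : 0 <= e * M by rewrite mulr_ge0 ?exprn_ge0 // ltW.
apply: le_trans (lerD (lexx _) (ler_wpM2l eM (fG n))) _.
have -> : c * F n.+2 = e * F n.+2 + e * M * (G * F n).
  by rewrite FSS -/M /e; field; rewrite gt_eqF // addr_gt0.
exact: lexx.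
Qed.

End Recursion.

(** * Back and forth *)

Close Scope ring_scope.

(** * Colourings as r-graphs *)

Section Graphs.
Variables (r : nat) (V : finType).
Implicit Types (D : coloring r V).

Definition graph_of D : r_graph r V := [ffun e => [set D e]].

Lemma graph_of_inj : injective graph_of.
Proof.
move=> D D' /ffunP E; apply/ffunP => e; apply/eqP.
by have := E e; rewrite !ffunE => /setP/(_ (D e)); rewrite !inE eqxx => <-.
Qed.

Lemma colors_graph_of D x y (i : 'I_r) :
  (colors (graph_of D) x y == [set i]) = (cdist D x y == i.+1).
Proof.
rewrite /colors /cdist; case: insub => [e|] /=.
  rewrite ffunE eqSS; apply/eqP/eqP => [/setP/(_ i)|E].
    by rewrite !inE eqxx => /eqP ->.
  by apply/setP => k; rewrite !inE -!(inj_eq val_inj) /= E.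
by apply/eqP => /setP/(_ i); rewrite !inE eqxx.
Qed.

Lemma dist_graph_of D x y : dist (graph_of D) x y = cdist D x y.
Proof.
rewrite /dist /colors /cdist; case: insub => [e|] /=.
  rewrite ffunE; case: pickP => [i|/(_ (D e))]; rewrite inE ?eqxx //.
  by move=> /eqP ->.
by case: pickP => // i; rewrite inE.
Qed.

Lemma interp_graph_of D (i : 'I_r) x y :
  interp (l := graph_structure (graph_of D)) i x y <-> cdist D x y = i.+1.
Proof.
split=> /= [[_ /eqP]|Ei]; first by rewrite colors_graph_of => /eqP.
split; last by apply/eqP; rewrite colors_graph_of; apply/eqP.
by move=> Exy; move: Ei; rewrite Exy cdistxx.
Qed.

Lemma triangle_graph_of D : triangle_ineq (graph_of D) = metric D.
Proof.
apply/forallP/metricP => [H x y z|mD x].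
  have /forallP/(_ y)/forallP/(_ z) := H x; rewrite !dist_graph_of.
  case: (eqVneq x y) => [->|xy]; first by rewrite cdistxx.
  case: (eqVneq y z) => [->|yz]; first by rewrite cdistxx addn0.
  by case: (eqVneq x z) => [->|xz]; first by rewrite cdistxx.
apply/forallP => y; apply/forallP => z; apply/implyP => _.
by rewrite !dist_graph_of.
Qed.

End Graphs.

Lemma card_M (r n : nat) (P : pred (r_graph r 'I_n)) :
  #|[set G in M r n | P G]|
    = #|[pred D : coloring r 'I_n | metric D & P (graph_of D)]|.
Proof.
rewrite -(card_imset _ (@graph_of_inj r 'I_n)); apply: eq_card => G.
rewrite !inE; apply/andP/imsetP => [[/and3P[/forallP sG /forallP cG tG] PG]|];
  last first.
  case=> D; rewrite inE => /andP[mD PD] ->; split=> //.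
  rewrite triangle_graph_of mD andbT; apply/andP.
  split; apply/forallP => e; rewrite ffunE ?cards1 //.
  by apply/set0Pn; exists (D e); rewrite inE.
have /fin_all_exists[D DG] e : exists i, G e = [set i].
  by apply/cards1P; rewrite eqn_leq sG card_gt0 cG.
have EG : G = graph_of [ffun e => D e] by apply/ffunP => e; rewrite !ffunE.
by exists [ffun e => D e]; rewrite // inE -triangle_graph_of -EG tG.
Qed.

(** The prescribed distances are positive, so [z] is automatically different from all [v i]. *)
Definition extension_property (m j : nat) (V : finType)
    (D : coloring (2 * m) V) : bool :=
  [forall v : {ffun 'I_j -> V}, forall c : {ffun 'I_j -> 'I_(2 * m)},
    (injectiveb v && [forall i, c i \in big_colors (2 * m) m]) ==>
      [exists z, forall i, cdist D z (v i) == (c i).+1]].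

(** All j up to k are included because a valuation of k variables may repeat vertices. *)
Definition extendable (m k : nat) (V : finType) (D : coloring (2 * m) V) :=
  forall j, j <= k -> extension_property j D.

Lemma extendable_maxn m k l (V : finType) (D : coloring (2 * m) V) :
  extendable (maxn k l) D -> extendable k D /\ extendable l D.
Proof. by move=> ext; split=> j le_j; apply: ext; rewrite leq_max le_j ?orbT. Qed.

(* The largest number of free variables of a quantified subformula, that is, the
   size of the partial isometries that back-and-forth has to extend. *)
Fixpoint quantifier_vars (r k : nat) (phi : formula r k) : nat :=
  match phi with
  | Equal _ _ _ | Rel _ _ _ _ => 0
  | Not _ p => quantifier_vars p
  | And _ p q | Or _ p q | Imply _ p q =>
    maxn (quantifier_vars p) (quantifier_vars q)
  | Forall k p | Exists k p => maxn k (quantifier_vars p)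
  end.

Section BackAndForth.
Variables (m : nat).

(** If [a] is already a value of [v], its partner is known. Otherwise its distances are all at least
    m, and the extension property is applied to the distinct values of [w]. *)
Lemma extend_partial_isometry (U V : finType) (D : coloring (2 * m) U)
    (E : coloring (2 * m) V) (k : nat) (v : 'I_k -> U) (w : 'I_k -> V) :
  all_big D -> extendable k E ->
  (forall i j, cdist D (v i) (v j) = cdist E (w i) (w j)) ->
  forall a, exists b, forall i, cdist D a (v i) = cdist E b (w i).
Proof.
move=> /all_bigP bigD extE iso a.
case: (pickP [pred i | a == v i]) => [i /eqP -> |a_notin]; first by exists (w i).
pose W := [set w i | i : 'I_k].
have Wk : #|W| <= k by rewrite -[leqRHS]card_ord leq_imset_card.
have /fin_all_exists[f wf] (l : 'I_#|W|) : exists i, enum_val l = w i.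
  by have /imsetP[i _ ->] := enum_valP l; exists i.
have /fin_all_exists[c cE] (l : 'I_#|W|) : exists i : 'I_(2 * m),
    cdist D a (v (f l)) = i.+1.
  by apply: cdist_color; have /= -> := a_notin (f l).
have /forallP/(_ (finfun (w \o f)))/forallP/(_ (finfun c)) := extE _ Wk.
have -> : injectiveb (finfun (w \o f)).
  by apply/injectiveP => l l'; rewrite !ffunE /= -!wf => /enum_val_inj.
have -> /= : [forall i, finfun c i \in big_colors (2 * m) m].
  apply/forallP => l; rewrite ffunE inE -cE bigD //.
  by have /= -> := a_notin (f l).
case/existsP=> b /forallP bE; exists b => i.
have wiW : w i \in W by apply: imset_f.
have := enum_rankK_in wiW wiW; set l := enum_rank_in _ _ => El.
have wE : w (f l) = w i by rewrite -wf.
(* Equal values of [w] come from equal values of [v]: their distance is 0. *)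
have vE : v (f l) = v i.
  by apply/eqP; rewrite -[_ == _]negbK -(cdist_gt0 D) iso wE cdistxx.
by have := bE l; rewrite !ffunE /= wE -cE vE => /eqP.
Qed.

Lemma extend_isometry (U V : finType) (D : coloring (2 * m) U)
    (E : coloring (2 * m) V) (k : nat) (v : 'I_k -> U) (w : 'I_k -> V)
    a b :
  (forall i j, cdist D (v i) (v j) = cdist E (w i) (w j)) ->
  (forall i, cdist D a (v i) = cdist E b (w i)) ->
  forall i j, cdist D (extend_valuation a v i) (extend_valuation a v j)
    = cdist E (extend_valuation b w i) (extend_valuation b w j).
Proof.
move=> iso ab i j; rewrite /extend_valuation.
case: unliftP => [i' _|_]; case: unliftP => [j' _|_] //=;
  last by rewrite !cdistxx.
by rewrite cdistC ab cdistC.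
Qed.

(** Induction on the formula, with partial isometries as the back-and-forth relation: equality is
    distance 0, and the relations are read off from distances. *)
Lemma holds_transfer (U V : finType) (D : coloring (2 * m) U)
    (E : coloring (2 * m) V) (k : nat) (phi : formula (2 * m) k) :
  all_big D -> all_big E ->
  extendable (quantifier_vars phi) D -> extendable (quantifier_vars phi) E ->
  forall (v : 'I_k -> U) (w : 'I_k -> V),
  (forall i j, cdist D (v i) (v j) = cdist E (w i) (w j)) ->
  holds (S := graph_structure (graph_of D)) phi v <->
  holds (S := graph_structure (graph_of E)) phi w.
Proof.
move=> bigD bigE.
elim: phi => {k} [k x y|k i x y|k p IHp|k p IHp q IHq|k p IHp q IHq|k p IHp q IHq
    |k p IHp|k p IHp] extD extE v w iso.
- change (v x = v y <-> w x = w y); split=> e; apply/eqP; rewrite -[_ == _]negbK.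
    by rewrite -(cdist_gt0 E) -iso e cdistxx.
  by rewrite -(cdist_gt0 D) iso e cdistxx.
- have iD := @interp_graph_of _ _ D i (v x) (v y).
  have iE := @interp_graph_of _ _ E i (w x) (w y).
  by apply: (iff_trans iD); rewrite iso; apply: iff_sym.
- by have := IHp extD extE v w iso => /= -> .
- have [pD qD] := extendable_maxn extD; have [pE qE] := extendable_maxn extE.
  by have := IHp pD pE v w iso; have := IHq qD qE v w iso => /= -> ->.
- have [pD qD] := extendable_maxn extD; have [pE qE] := extendable_maxn extE.
  by have := IHp pD pE v w iso; have := IHq qD qE v w iso => /= -> ->.
- have [pD qD] := extendable_maxn extD; have [pE qE] := extendable_maxn extE.
  by have := IHp pD pE v w iso; have := IHq qD qE v w iso => /= -> ->.
- have [kD pD] := extendable_maxn extD; have [kE pE] := extendable_maxn extE.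
  split=> /= H b.
    have [a ab] := extend_partial_isometry bigE kD (fun i j => esym (iso i j)) b.
    by apply/(IHp pD pE); last exact: (H a); apply: extend_isometry.
  have [a ab] := extend_partial_isometry bigD kE iso b.
  by apply/(IHp pD pE); last exact: (H a); apply: extend_isometry.
- have [kD pD] := extendable_maxn extD; have [kE pE] := extendable_maxn extE.
  split=> /= -[b Hb].
    have [a ab] := extend_partial_isometry bigD kE iso b.
    have [forth _] := IHp pD pE _ _ (extend_isometry iso ab).
    by exists a; apply: forth.
  have [a ab] := extend_partial_isometry bigE kD (fun i j => esym (iso i j)) b.
  have [_ back] := IHp pD pE _ _ (extend_isometry iso (fun i => esym (ab i))).
  by exists a; apply: back.
Qed.

End BackAndForth.

(** * Extension properties *)

Section Missing.
Local Open Scope nat_scope.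
Variables (m j : nat) (V : finType).
Hypothesis m0 : 0 < m.

Lemma card_family_prod (aT rT : finType) (F : aT -> {set rT}) :
  #|(family (fun x => mem (F x)) : pred {ffun aT -> rT})| = \prod_x #|F x|.
Proof. by rewrite card_family foldrE big_map big_enum. Qed.

(* The distances to the vertices v i of the other vertices are independent
   rows, each of which must differ from c. *)
Lemma card_missing (v : {ffun 'I_j -> V}) (c : {ffun 'I_j -> 'I_(2 * m)}) :
    injective v -> c \in ffun_on (mem (big_colors (2 * m) m)) ->
  #|[pred D : coloring (2 * m) V | all_big D &
      ~~ [exists z, forall i, cdist D z (v i) == (c i).+1]]|
       * (m.+1 ^ j) ^ (#|V| - j)
    <= m.+1 ^ 'C(#|V|, 2) * ((m.+1 ^ j).-1) ^ (#|V| - j).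
Proof.
move=> v_inj c_big.
pose W := [set z | z \notin codom v].
have WE : #|W| = #|V| - j.
  rewrite -(cardC (mem (codom v))) card_codom // card_ord addKn.
  by apply: eq_card => z; rewrite !inE.
have neqW z i : z \in W -> z != v i.
  by rewrite inE; apply: contraNneq => ->; apply: codom_f.
pose cut (e : edge V) := [exists z in W, exists i, val e == [set z; v i]].
have cut_ge : #|W| * j <= #|[pred e | cut e]|.
  pose h (p : V * 'I_j) := [set p.1; v p.2].
  have -> : #|W| * j = #|h @: finset.setX W [set: 'I_j]|.
    rewrite card_in_imset ?cardsX ?cardsT ?card_ord // => -[z i] [z' i'] /=.
    rewrite !inE /h /= !andbT => zW z'W E.
    have z'v : z' != v i' by apply: neqW; rewrite inE.
    have [[-> /v_inj ->] //|[Ez _]] := set2_eq z'v E.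
    by case/negP: z'W; rewrite Ez codom_f.
  rewrite -(card_imset [pred e | cut e] val_inj).
  apply/subset_leq_card/subsetP => _ /imsetP[[z i] + ->];
    rewrite !inE andbT /= => zW.
  have zv : z != v i by apply: neqW; rewrite inE.
  have [e _ Ee] := insub_pairP zv; apply/imsetP; exists e; last by rewrite Ee.
  rewrite inE; apply/existsP; exists z; rewrite inE zW /=.
  by apply/existsP; exists i; rewrite Ee.
have c1 : 'I_(2 * m) by exists 0; rewrite muln_gt0.
pose col (D : coloring (2 * m) V) x y := oapp D c1 (insub [set x; y]).
have colE D e x y : val e = [set x; y] -> col D x y = D e.
  by rewrite /col => /insub_edge ->.
(* The colours of cut edges are stored in the rows of the vertices in [W]; the cut edges themselves
   and the rows of the [v i] get the dummy [c1]. *)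
pose F1 e := if cut e then [set c1] else big_colors (2 * m) m.
pose F2 z : {set {ffun 'I_j -> 'I_(2 * m)}} :=
  if z \in W then [set x in ffun_on (mem (big_colors (2 * m) m))] :\ c
  else [set [ffun=> c1]].
pose enc (D : coloring (2 * m) V) := ([ffun e => if cut e then c1 else D e],
  [ffun z => if z \in W then [ffun i => col D z (v i)] else [ffun=> c1]]).
have enc_inj : injective enc.
  move=> D D' [/ffunP E1 /ffunP E2]; apply/ffunP => e.
  case: (boolP (cut e)) => [/existsP[z /andP[zW /existsP[i /eqP Ee]]]|ncut].
    have := E2 z; rewrite !ffunE zW => /ffunP/(_ i).
    by rewrite !ffunE !(colE _ _ _ _ Ee).
  by have := E1 e; rewrite !ffunE (negPf ncut).
have le_card : #|[pred D : coloring (2 * m) V | all_big D &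
      ~~ [exists z, forall i, cdist D z (v i) == (c i).+1]]|
    <= (\prod_e #|F1 e|) * (\prod_z #|F2 z|).
  rewrite -!card_family_prod -cardX -(card_image enc_inj).
  apply/subset_leq_card/subsetP => _ /imageP[D + ->];
    rewrite !inE => /andP[bigD noz].
  have /forallP bigDe := bigD.
  apply/andP; split; apply/familyP => x; rewrite ffunE.
    by rewrite /F1; case: (cut x); [apply: set11 | apply: bigDe].
  rewrite /F2; case: ifP => [xW|_]; last exact: set11.
  have xv i := neqW x i xW.
  rewrite !inE; apply/andP; split.
    apply: contraNneq noz => E; apply/existsP; exists x; apply/forallP => i.
    have [e _ Ee] := insub_pairP (xv i).
    by rewrite (cdist_edge D Ee) -E ffunE (colE _ _ _ _ Ee).
  apply/ffun_onP => i; rewrite ffunE.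
  by have [e _ Ee] := insub_pairP (xv i); rewrite (colE _ _ _ _ Ee) bigDe.
have F1E : \prod_e #|F1 e| = m.+1 ^ #|[predC [pred e | cut e]]|.
  rewrite -prod_nat_const [RHS]big_mkcond; apply: eq_bigr => e _.
  by rewrite /F1 !inE; case: (cut e); rewrite /= ?cards1 ?card_big_colors.
have F2E : \prod_z #|F2 z| = (m.+1 ^ j).-1 ^ (#|V| - j).
  rewrite -WE -prod_nat_const [RHS]big_mkcond; apply: eq_bigr => z _.
  rewrite /F2; case: ifP => _; last by rewrite cards1.
  rewrite -[in RHS](card_big_colors m0) -[j in RHS](card_ord j) -card_ffun_on.
  by rewrite (cardD1 c (ffun_on _)) c_big; apply: eq_card => x; rewrite !inE.
rewrite F1E F2E in le_card.
apply: leq_trans (leq_mul le_card (leqnn _)) _.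
rewrite mulnAC leq_mul2r -expnM -expnD leq_exp2l // -card_edges.
rewrite -(cardC [pred e | cut e]) addnC mulnC -WE leq_add2r.
by rewrite cut_ge orbT.
Qed.
End Missing.

Section Rare.
Local Open Scope ring_scope.
Variables (R : realType) (m : nat).
Hypothesis m0 : (0 < m)%N.

(** There are polynomially many pairs (v, c), and by [card_missing] each lacks a witness in a
    proportion at most (1 - 1 / Y)^(n - j) <= exp (- a (n - j)) of the colourings. *)
Lemma rare_not_extension (j : nat) (c : R) : 0 < c ->
  exists n0 : nat, forall n, (n0 <= n)%N ->
  #|[pred D : coloring (2 * m) 'I_n | all_big D & ~~ extension_property j D]|%:R
    <= c * m.+1%:R ^+ 'C(n, 2).
Proof.
move=> c0; have [Y Y0 YE] : exists2 Y : R, 0 < Y & Y = (m.+1 ^ j)%:R.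
  by eexists; last reflexivity; rewrite ltr0n expn_gt0.
have [a a0 aE] : exists2 a : R, 0 < a & a = Y^-1.
  by eexists; last reflexivity; rewrite invr_gt0.
have a20 : 0 < a / 2 by rewrite divr_gt0.
(* The term of degree j + 1 of the exponential series gives n^j <= n^(j + 1) <= H exp (a n / 2),
   which uses only half of the decay. *)
have [H H0 HE] : exists2 H : R, 0 < H & H = (j.+1)`!%:R / (a / 2) ^+ j.+1.
  by eexists; last reflexivity; rewrite divr_gt0 ?exprn_gt0 // ltr0n fact_gt0.
have [rj rj0 rjE] : exists2 rj : R, 0 < rj & rj = ((2 * m) ^ j)%:R.
  by eexists; last reflexivity; rewrite ltr0n expn_gt0 muln_gt0 m0.
have [n0 Hn0] := linear_dominates (ln (H * rj) + a * j%:R - ln c) a20.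
exists (n0 + j).+1 => n le_n.
have [n1 jn n0n] : [/\ 0 < n, j <= n & n0 <= n]%N.
  by move: le_n; clear => le_n; split; lia.
pose X : R := m.+1%:R ^+ 'C(n, 2) * expR (- a * (n - j)%:R).
pose P (q : {ffun 'I_j -> 'I_n} * {ffun 'I_j -> 'I_(2 * m)})
    (D : coloring (2 * m) 'I_n) :=
  [&& injectiveb q.1, q.2 \in ffun_on (mem (big_colors (2 * m) m)), all_big D &
    ~~ [exists z, forall i, cdist D z (q.1 i) == (q.2 i).+1]].
apply: (@le_trans _ _ (#|{: {ffun 'I_j -> 'I_n} * {ffun 'I_j ->
  'I_(2 * m)}}|%:R * X)).
  apply: (@union_bound R _ _ _ P) => [D /andP[bigD]|[v k]].
    rewrite negb_forall => /existsP[v]; rewrite negb_forall => /existsP[k].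
    rewrite negb_imply => /andP[/andP[v_inj /forallP kbig] noz].
    by exists (v, k); apply/and4P; split=> //; apply/ffun_onP.
  case: (boolP (injectiveb v)) => [/injectiveP v_inj|v_ninj]; last first.
    rewrite eq_card0 => [|D]; first by rewrite mulr_ge0 ?expR_ge0 ?exprn_ge0.
    by apply/negP => /and4P[]; rewrite (negPf v_ninj).
  case: (boolP (k \in ffun_on (mem (big_colors (2 * m) m)))) => [k_big|k_nbig];
    last first.
    rewrite eq_card0 => [|D]; first by rewrite mulr_ge0 ?expR_ge0 ?exprn_ge0.
    by apply/negP => /and4P[_]; rewrite (negPf k_nbig).
  have le_P : (#|P (v, k)| <= #|[pred D : coloring (2 * m) 'I_n | all_big D
      & ~~ [exists z, forall i, cdist D z (v i) == (k i).+1]]|)%N.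
    by apply/subset_leq_card/subsetP => D /and4P[_ _ h1 h2]; apply/andP.
  have := card_missing m0 v_inj k_big; rewrite card_ord.
  rewrite -(ler_nat R) in le_P; rewrite -(ler_nat R) !natrM !natrX => le_b.
  apply: le_trans le_P _; move: le_b; set b := #|[pred D | _ & _]|%:R => le_b.
  have Ym : (m.+1 ^ j).-1%:R = Y - 1 :> R.
    by rewrite YE -[in RHS](prednK (_ : 0 < m.+1 ^ j)%N) ?expn_gt0 // -natr1
      addrK.
  rewrite Ym -natrX -YE in le_b.
  rewrite /X expRM_natr; rewrite -(ler_pM2r (exprn_gt0 (n - j) Y0)).
  apply: le_trans le_b _; rewrite -mulrA -exprMn ler_wpM2l ?exprn_ge0 //.
  have Y1 : 1 <= Y by rewrite YE ler1n expn_gt0.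
  have le_Y : Y - 1 <= expR (- a) * Y.
    apply: (@le_trans _ _ ((1 - a) * Y)).
      by rewrite mulrBl mul1r aE mulVf ?gt_eqF.
    by rewrite ler_wpM2r ?(ltW Y0) // expR_ge1Dx.
  by rewrite lerXn2r ?nnegrE ?subr_ge0 // mulr_ge0 ?expR_ge0 // ltW.
rewrite card_prod !card_ffun !card_ord natrM -rjE.
rewrite /X mulrCA mulrC ler_wpM2r ?exprn_ge0 //.
have nj : (n ^ j)%:R <= H * expR (a / 2 * n%:R).
  apply: (@le_trans _ _ ((n ^ j.+1)%:R)); first by rewrite ler_nat leq_pexp2l.
  rewrite natrX HE -ler_pdivrMl ?divr_gt0 ?exprn_gt0 // ?ltr0n ?fact_gt0 //.
  have an0 : 0 <= a / 2 * n%:R by rewrite mulr_ge0 // ltW.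
  apply: le_trans _ (expR_ge1Dxn j an0).
  by rewrite invf_div mulrAC -exprMn lerDr.
have : (n ^ j)%:R * rj * expR (- a * (n - j)%:R)
    <= H * expR (a / 2 * n%:R) * rj * expR (- a * (n - j)%:R).
  by rewrite ler_wpM2r ?expR_ge0 // ler_wpM2r ?(ltW rj0).
move=> /le_trans; apply.
have -> : H * expR (a / 2 * n%:R) * rj * expR (- a * (n - j)%:R)
  = (H * rj) * (expR (a / 2 * n%:R) * expR (- a * (n - j)%:R)) by ring.
have Hrj : 0 < H * rj by apply: mulr_gt0.
rewrite -[H * rj]lnK ?posrE // -!expRD -[leRHS]lnK ?posrE // ler_expR natrB //.
have := Hn0 n n0n; lra.
Qed.

Lemma rare_not_extendable (k : nat) (c : R) : 0 < c ->
  exists n0 : nat, forall n, (n0 <= n)%N ->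
  #|[pred D : coloring (2 * m) 'I_n | all_big D &
      ~~ [forall j : 'I_k.+1, extension_property j D]]|%:R
    <= c * m.+1%:R ^+ 'C(n, 2).
Proof.
move=> c0; have ck : 0 < c / k.+1%:R by rewrite divr_gt0.
have /fin_all_exists[N HN] (j : 'I_k.+1) := rare_not_extension j ck.
exists (\max_j N j)%N => n le_n.
apply: (@le_trans _ _ (#|'I_k.+1|%:R * (c / k.+1%:R * m.+1%:R ^+ 'C(n, 2))));
  last first.
  by rewrite card_ord mulrA [_ * (c / _)]mulrC divfK ?pnatr_eq0.
apply: (@union_bound R _ _ _ (fun (j : 'I_k.+1) D =>
  all_big D && ~~ extension_property j D)).
  move=> D /andP[bigD]; rewrite negb_forall => /existsP[j nD].
  by exists j; rewrite bigD.
by move=> j; apply: HN; apply: leq_trans le_n; apply: leq_bigmax.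
Qed.

End Rare.

(** * The zero-one law *)

From mathcomp Require Import all_classical all_reals all_analysis.
Import numFieldNormedType.Exports.

Local Open Scope classical_set_scope.
Local Open Scope ring_scope.

Lemma models_transfer (m n n' : nat) (psi : sentence (2 * m))
    (D : coloring (2 * m) 'I_n) (E : coloring (2 * m) 'I_n') :
  all_big D -> all_big E ->
  extendable (quantifier_vars psi) D -> extendable (quantifier_vars psi) E ->
  models (graph_structure (graph_of D)) psi ->
  models (graph_structure (graph_of E)) psi.
Proof.
move=> bigD bigE extD extE modD w.
(* The empty valuation, available even when n = 0. *)
pose v (i : 'I_0) : 'I_n := let: Ordinal _ lt_i := i in False_rect _ (notF lt_i).
have [forth _] := holds_transfer bigD bigE extD extE (v := v) (w :=
  w) ltac:(by case).
exact: forth.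
Qed.

(** All colourings outside [bad], of any sizes, agree on [psi]. If one of them satisfies it, the
    failures lie in [bad] and the limit is 1; if none does, the models lie in [bad] and the limit is
    0. *)
Lemma zero_one_law (R : realType) (m : nat) (psi : sentence (2 * m)) : (1 <
  m)%N ->
  let count n := #|[set G in M (2 * m) n |
    `[< models (graph_structure G) psi >]]%SET| in
  let ratio n : R := (count n)%:R / #|M (2 * m) n|%:R in
  (ratio n @[n --> \oo] --> (0 : R)) \/ (ratio n @[n --> \oo] --> (1 : R)).
Proof.
move=> m1 count ratio; have m0 := ltnW m1.
pose k := quantifier_vars psi.
pose P n (D : coloring (2 * m) 'I_n) :=
  `[< models (graph_structure (graph_of D)) psi >].
pose ext n (D : coloring (2 * m) 'I_n) :=
  [forall j : 'I_k.+1, extension_property j D].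
have extP n (D : coloring (2 * m) 'I_n) : ext n D -> extendable k D.
  by move=> /forallP H j; rewrite -ltnS => lt_j; apply: (H (Ordinal lt_j)).
pose f n := #|[pred D : coloring (2 * m) 'I_n | metric D]|.
have ME n : #|M (2 * m) n| = f n.
  have -> : M (2 * m) n = [set G in M (2 * m) n | xpredT G]%SET.
    by apply/setP => G; rewrite inE andbT.
  by rewrite card_M; apply: eq_card => D; rewrite !inE andbT.
have countE n : count n = #|[pred D : coloring (2 * m) 'I_n | metric D & P n D]|.
  exact: card_M.
pose bad n := #|[pred D : coloring (2 * m) 'I_n |
  metric D & ~~ (all_big D && ext n D)]|.
have f_gt0 n : (0 < f n)%N.
  have lt0 : (m.+1 ^ 'C(n, 2) <= f n)%N.
    rewrite -[n in 'C(n, _)]card_ord -(card_all_big _ m0).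
    apply/subset_leq_card/fintype.subsetP => D; rewrite !inE;
      exact: all_big_metric.
  by apply: leq_trans lt0; rewrite expn_gt0.
have badE (e : R) : 0 < e -> exists n0, forall n, (n0 <= n)%N ->
  (bad n)%:R <= e * (f n)%:R.
  move=> e0; have e20 : 0 < e / 2 by rewrite divr_gt0.
  have [n1 H1] := mostly_all_big m1 e20.
  have [n2 H2] := rare_not_extendable m0 k e20.
  exists (maxn n1 n2) => n; rewrite geq_max => /andP[/H1 {}H1 /H2 {}H2].
  apply: (@le_trans _ _ (e * m.+1%:R ^+ 'C(n, 2))).
    rewrite [e]splitr mulrDl; apply: le_trans _ (lerD H1 H2).
    rewrite -natrD ler_nat; apply: leq_trans _ (card_predU_le _ _).
    apply/subset_leq_card/fintype.subsetP => D; rewrite !inE => /andP[mD].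
    by rewrite negb_and mD /=; case: (all_big D).
  rewrite ler_wpM2l ?(ltW e0) // -natrX ler_nat.
  rewrite -[n in 'C(n, _)]card_ord -(card_all_big _ m0).
  apply/subset_leq_card/fintype.subsetP => D; rewrite !inE; exact: all_big_metric.
have ratio_bound (l : R) : (forall n, `|l * (f n)%:R - (count n)%:R| <=
  (bad n)%:R :> R) ->
    ratio n @[n --> \oo] --> l.
  move=> Hl; apply/cvgrPdist_le => e e0; have [n0 Hn0] := badE e e0.
  exists n0 => // n /= le_n; rewrite /ratio ME.
  have fn0 : 0 < (f n)%:R :> R by rewrite ltr0n.
  rewrite -(ler_pM2r fn0) -{2}(gtr0_norm fn0) -normrM mulrBl divfK ?gt_eqF //.
  exact: le_trans (Hl n) (Hn0 n le_n).
have [[n [D [bigD extD modD]]]|none] :=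
  pselect (exists n (D : coloring (2 * m) 'I_n),
    [/\ all_big D, ext n D & models (graph_structure (graph_of D)) psi]).
  right; apply: ratio_bound => n'.
  have -> : f n' = (count n' + #|[pred E : coloring (2 * m) 'I_n' |
    metric E & ~~ P n' E]|)%N.
    rewrite countE /f -(cardID [pred E | P n' E]); congr (_ + _)%N.
    by apply: eq_card => E; apply: andbC.
  rewrite mul1r natrD addrAC subrr add0r ger0_norm // ler_nat.
  apply/subset_leq_card/fintype.subsetP => E; rewrite !inE => /andP[-> nP] /=.
  apply: contra nP => /andP[bigE extE]; apply/asboolP.
  exact: models_transfer bigD bigE (extP _ _ extD) (extP _ _ extE) modD.
left; apply: ratio_bound => n;
  rewrite mul0r sub0r normrN ger0_norm // ler_nat countE.
apply/subset_leq_card/fintype.subsetP => D;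
  rewrite !inE => /andP[-> /asboolP modD] /=.
by apply/negP => /andP[bigD extD]; apply: none; exists n, D.
Qed.

Theorem theorem1p7 (R : realType) (r : nat) (r_ge4 : (4 <= r)%N)
    (r_even : ~~ odd r) (psi : sentence r) :
  let ratio (n : nat) : R :=
    #|[set G in M r n | `[< models (graph_structure G) psi >]]%SET|%:R
      / #|M r n|%:R in
  (ratio n @[n --> \oo] --> (0 : R)) \/ (ratio n @[n --> \oo] --> (1 : R)).
Proof.
have rE : r = (2 * r./2)%N by rewrite mul2n even_halfK.
have half1 : (1 < r./2)%N by rewrite -(leq_pmul2l (_ : 0 < 2)%N) // -rE.
move: psi; rewrite rE => psi; exact: zero_one_law.
Qed.
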